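(* Let $n,k\ge1$, let $G$ be a Dedekind $\sigma$-complete $\ell$-group, let $M=\Gamma(\mathbb Z\,\overrightarrow{\times}\,G,(k,0))$ be the corresponding $k$-perfect MV-algebra, and let $F:\mathbb R^n\to M$ be an $n$-dimensional spectral resolution on $M$ with the ordering property. Then there is a unique $n$-dimensional observable $x$ on $M$ which is an extension of $F$, i.e. such that $x((-\infty,t_1)\times\cdots\times(-\infty,t_n))=F(t_1,\ldots,t_n)$ for all $(t_1,\ldots,t_n)\in\mathbb R^n$.
   Context: All groups are Abelian and written additively. An $\ell$-group $G$ is Dedekind $\sigma$-complete if every nonempty countable subset of $G$ bounded above has a supremum in $G$. $\mathbb Z\,\overrightarrow{\times}\,G$ is $\mathbb Z\times G$ with lexicographic order: $(m,g)\le(m',g')$ iff $m<m'$, or $m=m'$ and $g\le g'$. $\Gamma(\mathbb Z\,\overrightarrow{\times}\,G,(k,0))$ is the interval $[(0,0),(k,0)]$ with its usual MV-algebra structure ($a\oplus b=(a+b)\wedge(k,0)$, $a'=(k,0)-a$); bottom $0=(0,0)$, top $1=(k,0)$. The partial addition $a+b$ on $M$ is the group sum, defined when it is $\le(k,0)$. $M$ is the disjoint union of $M_0=\{0\}\times G^+$, $M_j=\{j\}\times G$ for $0<j<k$, and $M_k=\{k\}\times G^-$, where $G^+$ and $G^-$ are the sets of elements $\ge 0$ and $\le 0$ of $G$. Suprema and infima below are taken in $M$. For $s,t\in\mathbb R^n$, $s\ll t$ (equivalently $t\gg s$) means $s_i<t_i$ for all $i$; $s\le t$ and $s\wedge t$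 are coordinatewise. For $F:\mathbb R^n\to M$ and reals $a\le b$, $\Delta_i(a,b)F$ is the function of the remaining variables $F(\ldots,t_{i-1},b,t_{i+1},\ldots)-F(\ldots,t_{i-1},a,t_{i+1},\ldots)$, computed in $\mathbb Z\,\overrightarrow{\times}\,G$. An $n$-dimensional spectral resolution on $M$ is a map $F:\mathbb R^n\to M$ such that: (i) (volume condition) $\Delta_1(a_1,b_1)\cdots\Delta_n(a_n,b_n)F\ge0$ for all reals $a_i\le b_i$; (ii) $\bigvee_{s\ll t}F(s)=F(t)$ for all $t\in\mathbb R^n$; (iii) $\bigwedge_{t_i\in\mathbb R}F(s_1,\ldots,s_{i-1},t_i,s_{i+1},\ldots,s_n)=0$ for each $i$ and all fixed values of the other variables; (iv) $\bigvee_{s\in\mathbb R^n}F(s)=1$; (v) for every characteristic point $\mathbf t^B$ of $F$, corresponding to a block $B\subseteq T_j$, the element $a_B=\bigwedge\{F(s): s\gg\mathbf t^B\}$ exists in $M$ and belongs to $M_j$. Here, for $j=1,\ldots,k$, $T_j=\{t\in\mathbb R^n: F(t)\in M_j\}$. On $T_j$ one puts $s\sim t$ iff $s\wedge t\in T_j$; for $F$ satisfying (i)–(iv) this is an equivalence relation, and its classes are called blocks. The characteristic point of a block $B$ is the coordinatewise infimum $\mathbf t^B$ of $B$; the characteristic points of $T_j$ are those of its blocks, and the characteristic points of $F$ are those of all the blocks of $T_1,\ldots,T_k$. $F$ has the ordering property if (1) every non-empty $T_j$, $j=1,\ldots,k$, has at most one characteristic point, and (2) whenever $0<i<j\le k$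 and $\mathbf t_i,\mathbf t_j$ are characteristic points of $T_i$ and $T_j$, respectively, then $\mathbf t_i\le\mathbf t_j$. An $n$-dimensional observable on $M$ is a map $x:\mathcal B(\mathbb R^n)\to M$ on the Borel $\sigma$-algebra such that $x(\mathbb R^n)=1$; $x(A\cup B)=x(A)+x(B)$ (the sum being defined in $M$) for disjoint Borel sets $A,B$; and $x(\bigcup_iA_i)=\bigvee_i x(A_i)$ for every non-decreasing sequence $(A_i)_i$ of Borel sets. *)

(* Defs.v *)
From HB Require Import structures.
From mathcomp Require Import all_boot all_order all_algebra.
From mathcomp Require Import all_classical all_reals all_analysis.

Set Implicit Arguments.
Unset Strict Implicit.
Unset Printing Implicit Defensive.

Import Order.TTheory GRing.Theory Num.Theory.
Import numFieldNormedType.Exports.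

Local Open Scope classical_set_scope.
Local Open Scope ring_scope.

(** * Abelian lattice-ordered groups *)

(* The order is a lattice; [supremums A x] says that [x] is the least upper
   bound of [A], and [infimums A x] that it is the greatest lower bound.  The
   library's [Order.Lattice] is not used because Hierarchy Builder rejects its
   join with [Num.POrderedZmodule] declared after [Num.RealDomain]. *)
HB.mixin Record POrderedZmodule_isLGroup G of Num.POrderedZmodule G := {
  lgroup_leD2l : forall z x y : G, x <= y -> z + x <= z + y ;
  lgroup_join : forall x y : G, exists z, supremums [set x; y] z ;
  lgroup_meet : forall x y : G, exists z, infimums [set x; y] z
}.

#[short(type="lgroupType")]
HB.structure Definition LGroup :=
  { G of Num.POrderedZmodule G & POrderedZmodule_isLGroup G }.

Definition dedekind_sigma_complete (G : lgroupType) : Prop :=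
  forall A : set G, A !=set0 -> countable A -> has_ubound A ->
    exists x, supremums A x.

(** * The lexicographic product of Z with G, and its unit interval *)

Definition lexZ (G : lgroupType) : Type := int *lexi[ring_display] G.

HB.instance Definition _ (G : lgroupType) :=
  Order.POrder.copy (lexZ G) (int *lexi[ring_display] G).
HB.instance Definition _ (G : lgroupType) :=
  GRing.Zmodule.copy (lexZ G) (int * G)%type.

Lemma lexZ_leE (G : lgroupType) (x y : lexZ G) :
  x <= y <-> x.1 < y.1 \/ x.1 = y.1 /\ x.2 <= y.2.
Proof.
rewrite Order.ProdLexiOrder.leEprodlexi; case: (ltgtP x.1 y.1) => /=.
- by move=> _; split=> // ?; left.
- by move=> xy; split=> // -[//|[e _]]; rewrite e ltxx in xy.
- by move=> ->; split=> [?|[//|[]]] //; right.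
Qed.

(* The carrier of Gamma(Z x G, (k, 0)).  It is ordered as a subset of
   [lexZ G], so suprema and infima in this type are taken in the interval. *)
Definition gammaZ (G : lgroupType) (k : nat) : Type :=
  {x : lexZ G | 0 <= x <= ((k%:Z, 0) : lexZ G)}.

HB.instance Definition _ (G : lgroupType) (k : nat) :=
  SubChoice.copy (gammaZ G k) {x : lexZ G | 0 <= x <= ((k%:Z, 0) : lexZ G)}.
HB.instance Definition _ (G : lgroupType) (k : nat) :=
  [SubChoice_isSubPOrder of gammaZ G k by <: with ring_display].

Section Interval.
Variables (G : lgroupType) (k : nat).

Lemma lexZ_top_ge0 : 0 <= ((k%:Z, 0) : lexZ G).
Proof.
apply/lexZ_leE; case: k => [|m]; first by right.
by left.
Qed.

Fact gamma0_subproof : 0 <= (0 : lexZ G) <= ((k%:Z, 0) : lexZ G).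
Proof. by rewrite lexx lexZ_top_ge0. Qed.

Fact gamma1_subproof :
  0 <= ((k%:Z, 0) : lexZ G) <= ((k%:Z, 0) : lexZ G).
Proof. by rewrite lexx lexZ_top_ge0. Qed.

Definition gamma0 : gammaZ G k := exist _ 0 gamma0_subproof.
Definition gamma1 : gammaZ G k := exist _ ((k%:Z, 0) : lexZ G) gamma1_subproof.

(* [a + b] is defined in the interval and equal to [c]: the group sum is then
   [val c], so that it lies below [(k, 0)]. *)
Definition gamma_add_eq (a b c : gammaZ G k) : Prop := val a + val b = val c.

(* The elements of the interval with first coordinate [j]: {0} x G^+ for
   j = 0, {j} x G for 0 < j < k, and {k} x G^- for j = k. *)
Definition gamma_level (j : nat) : set (gammaZ G k) :=
  [set a | (val a).1 = j%:Z].

End Interval.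

Arguments gamma0 {G k}.
Arguments gamma1 {G k}.
Arguments gamma_level {G k} j.

(** * Points of R^n *)

Section Points.
Variables (R : realType) (n : nat).
Implicit Types s t : 'rV[R]_n.

Definition lev s t : Prop := forall i, s 0 i <= t 0 i.
Definition ltv s t : Prop := forall i, s 0 i < t 0 i.
Definition minv s t : 'rV[R]_n := \row_i Num.min (s 0 i) (t 0 i).

Definition subst_coord t (i : 'I_n) (r : R) : 'rV[R]_n :=
  \row_j (if j == i then r else t 0 j).

Definition lower_orthant t : set 'rV[R]_n := [set s | ltv s t].

Definition borel_rV : set_system 'rV[R]_n :=
  <<s [set U : set 'rV[R]_n | open U] >>.

End Points.

(** * Spectral resolutions *)

Section Spectral.
Variables (R : realType) (n k : nat) (G : lgroupType).
Implicit Types (F : 'rV[R]_n -> gammaZ G k) (H : 'rV[R]_n -> lexZ G).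
Implicit Types (s t : 'rV[R]_n) (B : set 'rV[R]_n).

(* The result does not depend on the [i]-th coordinate of its argument: it
   stands for a function of the remaining variables. *)
Definition diff_coord (i : 'I_n) (a b : R) H : 'rV[R]_n -> lexZ G :=
  fun t => H (subst_coord t i b) - H (subst_coord t i a).

Definition iter_diff (a b : 'I_n -> R) H : 'rV[R]_n -> lexZ G :=
  foldr (fun i H' => diff_coord i (a i) (b i) H') H (enum 'I_n).

Definition volume_condition F : Prop :=
  forall a b : 'I_n -> R, (forall i, a i <= b i) ->
    forall t, 0 <= iter_diff a b (fun s => val (F s)) t.

Definition level_set F (j : nat) : set 'rV[R]_n :=
  [set t | gamma_level j (F t)].

Definition level_rel F (j : nat) s t : Prop := level_set F j (minv s t).

(* The classes of [level_rel F j] in [level_set F j]; these are honest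
   equivalence classes as soon as [F] satisfies the conditions of
   [spectral_resolution] other than the last. *)
Definition block F (j : nat) B : Prop :=
  exists2 t, level_set F j t &
    B = [set s | level_set F j s /\ level_rel F j s t].

Definition char_point_of B t : Prop :=
  forall i, infimums [set s 0 i | s in B] (t 0 i).

Definition char_point F (j : nat) t : Prop :=
  exists2 B, block F j B & char_point_of B t.

Record spectral_resolution F : Prop := SpectralResolution {
  spectral_volume : volume_condition F ;
  spectral_left_cont : forall t,
    supremums [set F s | s in [set s | ltv s t]] (F t) ;
  spectral_inf : forall (s : 'rV[R]_n) (i : 'I_n),
    infimums (range (fun r => F (subst_coord s i r))) gamma0 ;
  spectral_sup : supremums (range F) gamma1 ;
  spectral_char : forall (j : nat) B t, (0 < j <= k)%N ->
    block F j B -> char_point_of B t ->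
    exists2 a, infimums [set F s | s in [set s | ltv t s]] a &
               gamma_level j a
}.

Definition ordering_property F : Prop :=
  (forall j : nat, (0 < j <= k)%N -> level_set F j !=set0 ->
     forall s t, char_point F j s -> char_point F j t -> s = t) /\
  (forall i j : nat, (0 < i)%N -> (i < j)%N -> (j <= k)%N ->
     forall s t, char_point F i s -> char_point F j t -> lev s t).

(** * Observables *)

(* As for the measures of the library, an observable is a total function on
   sets, of which only the values on Borel sets are meaningful. *)
Record observable (x : set 'rV[R]_n -> gammaZ G k) : Prop := Observable {
  observable_setT : x setT = gamma1 ;
  observable_add : forall A B, borel_rV A -> borel_rV B ->
    A `&` B = set0 -> gamma_add_eq (x A) (x B) (x (A `|` B)) ;
  observable_sup : forall A : nat -> set 'rV[R]_n,
    (forall i, borel_rV (A i)) ->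
    (forall i j, (i <= j)%N -> A i `<=` A j) ->
    supremums (range (fun i => x (A i))) (x (\bigcup_i A i))
}.

Definition extends_spectral (x : set 'rV[R]_n -> gammaZ G k) F : Prop :=
  forall t, x (lower_orthant t) = F t.

End Spectral.

(* Main.v *)
Require Import Defs.
From HB Require Import structures.
From mathcomp Require Import all_boot all_order all_algebra.
From mathcomp Require Import ring lra zify.
From mathcomp Require Import all_classical all_reals all_analysis.
Import Order.TTheory GRing.Theory Num.Theory.
Import numFieldNormedType.Exports.
Local Open Scope classical_set_scope.
Local Open Scope ring_scope.

(* The words over {false, true} index nested cells of R^n, the m-th bit telling
   whether a point satisfies the m-th inequality [t_i < q] of an enumeration with
   [q] rational.  A spectral resolution gives each cell a mass in Z lex G, that
   is, a finitely additive positive tree of weights, and an observable is the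
   image of a sigma-additive extension of this tree to the Borel sets of the
   path space {0,1}^N.

   When the weights lie in G, such an extension always exists.  Composing with a
   real-valued state of G one gets a real tree, which extends to a measure by
   cutting an interval of R into nested subintervals.  The sets whose real
   measures are represented, for almost every state, by one element of G form a
   Dynkin class; states separate the elements of G even after discarding those
   at which countably many given sequences decreasing to 0 fail to converge to 0
   (a Rasiowa-Sikorski argument in the spirit of the Loomis-Sikorski theorem).

   In Z lex G the paths along which the first coordinate stays positive carry
   point masses.  Condition (v) bounds the weights from below along such a path,
   inside the level where they stabilize; subtracting finitely many point masses
   leaves a tree with weights in G. *)

Set Implicit Arguments.
Unset Strict Implicit.
Unset Printing Implicit Defensive.

(** * Order and disjointness in l-groups *)

(** A state of G need not preserve countable suprema, so real measures found state by state do not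
    fit together at once. Each increasing union used to reach a measurable set of paths adds one
    sequence, the gaps to a supremum in G, along which a state may fail to converge; a given set
    costs countably many of them, which is what the separation of elements tolerates.

    States cannot be used on Z lex G directly: they vanish on G, since all multiples of an element
    of G lie below (1, 0). Nor is Z lex G Dedekind sigma-complete for nontrivial G: the multiples
    (0, ng) of some g > 0 are bounded but have no supremum. Suprema are therefore formed only for
    sequences that end up bounded inside one level.

    F has no value at infinity, so the mass of an unbounded cell is a supremum over truncations; it
    exists because level k is reached at a finite point, after which no cell changes level. Along a
    path the lower corners increase, whereas condition (v) controls F from above a characteristic
    point; the cells are trimmed at their limit point, and the slices removed have level 0 by left
    continuity. *)

Section LGroupOrder.
Variable G : lgroupType.
Implicit Types x y z t : G.

Lemma lg_leD2l z x y : (z + x <= z + y) = (x <= y).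
Proof.
apply/idP/idP => [h|]; last exact: lgroup_leD2l.
by have := lgroup_leD2l (- z) _ _ h; rewrite !addKr.
Qed.

Lemma lg_leD2r z x y : (x + z <= y + z) = (x <= y).
Proof. by rewrite ![_ + z]addrC lg_leD2l. Qed.

Lemma lg_leBlDr z x y : (x - z <= y) = (x <= y + z).
Proof. by rewrite -[LHS](lg_leD2r z) subrK. Qed.

Lemma lg_leBrDr z x y : (x <= y - z) = (x + z <= y).
Proof. by rewrite -[LHS](lg_leD2r z) subrK. Qed.

Lemma lg_leBlDl z x y : (x - z <= y) = (x <= z + y).
Proof. by rewrite lg_leBlDr addrC. Qed.

Lemma lg_leBrDl z x y : (x <= y - z) = (z + x <= y).
Proof. by rewrite lg_leBrDr addrC. Qed.

Lemma lg_subr_ge0 x y : (0 <= y - x) = (x <= y).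
Proof. by rewrite lg_leBrDr add0r. Qed.

Lemma lg_subr_le0 x y : (x - y <= 0) = (x <= y).
Proof. by rewrite lg_leBlDr add0r. Qed.

Lemma lg_leN2 x y : (- x <= - y) = (y <= x).
Proof. by rewrite -[LHS]lg_subr_ge0 opprK addrC lg_subr_ge0. Qed.

Lemma lg_oppr_le0 x : (- x <= 0) = (0 <= x).
Proof. by rewrite -{1}oppr0 lg_leN2. Qed.

Lemma lg_leD x y z t : x <= y -> z <= t -> x + z <= y + t.
Proof.
by move=> xy zt; apply: (@le_trans _ _ (y + z)); rewrite ?lg_leD2l ?lg_leD2r.
Qed.

Lemma lg_addr_ge0 x y : 0 <= x -> 0 <= y -> 0 <= x + y.
Proof. by move=> x0 y0; rewrite -(addr0 0) lg_leD. Qed.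

Lemma lg_leDl x y : 0 <= y -> x <= x + y.
Proof. by move=> y0; rewrite -{1}(addr0 x) lg_leD2l. Qed.

Lemma lg_leDr x y : 0 <= y -> x <= y + x.
Proof. by rewrite addrC; exact: lg_leDl. Qed.

Lemma lg_gerBl x y : 0 <= y -> x - y <= x.
Proof. by move=> y0; rewrite lg_leBlDr lg_leDl. Qed.

Lemma lg_leB x y z t : x <= y -> t <= z -> x - z <= y - t.
Proof. by move=> xy tz; apply: lg_leD => //; rewrite lg_leN2. Qed.

Lemma lg_leMn n x y : x <= y -> x *+ n <= y *+ n.
Proof.
by move=> xy; elim: n => [|n IH]; rewrite ?mulr0n// !mulrS lg_leD.
Qed.

Lemma lg_mulrn_ge0 n x : 0 <= x -> 0 <= x *+ n.
Proof. by move=> /(@lg_leMn n); rewrite mul0rn. Qed.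

Lemma lg_leMn2 x m n : 0 <= x -> (m <= n)%N -> x *+ m <= x *+ n.
Proof.
by move=> x0 /subnKC <-; rewrite mulrnDr lg_leDl// lg_mulrn_ge0.
Qed.

Definition posp x : G := projT1 (cid (lgroup_join x 0)).

Let pospP x : supremums [set x; 0] (posp x).
Proof. by rewrite /posp; case: cid. Qed.

Lemma posp_ge x : x <= posp x.
Proof. by have [+ _] := pospP x; apply; left. Qed.

Lemma posp_ge0 x : 0 <= posp x.
Proof. by have [+ _] := pospP x; apply; right. Qed.

Lemma posp_le x z : x <= z -> 0 <= z -> posp x <= z.
Proof. by have [_ +] := pospP x => h xz z0; apply: h => _ [->|->]. Qed.

Lemma posp_id x : 0 <= x -> posp x = x.
Proof. by move=> x0; apply/eqP; rewrite eq_le posp_ge posp_le. Qed.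

(** For positive elements this says that the meet is 0, phrased by lower bounds so that no meet has
    to be named. *)
Definition disjoint_elts x y : Prop := forall d, d <= x -> d <= y -> d <= 0.

Lemma disjoint_eltsC x y : disjoint_elts x y -> disjoint_elts y x.
Proof. by move=> h d dx dy; exact: h. Qed.

Lemma disjoint_elts_le x x' y :
  x' <= x -> disjoint_elts x y -> disjoint_elts x' y.
Proof. by move=> xx h d dx dy; apply: h => //; exact: le_trans dx xx. Qed.

(** If [d] is below [x + y] and [z], then [d - y] is below [x] and [z], hence [d <= y], and the
    second disjointness applies. *)
Lemma disjoint_eltsD x y z : 0 <= y ->
  disjoint_elts x z -> disjoint_elts y z -> disjoint_elts (x + y) z.
Proof.
move=> y0 xz yz d dxy dz; apply: yz => //.
rewrite -lg_subr_le0; apply: xz; first by rewrite lg_leBlDr.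
by rewrite (le_trans _ dz)// lg_gerBl.
Qed.

Lemma disjoint_eltsMn n x z : 0 <= x -> 0 <= z ->
  disjoint_elts x z -> disjoint_elts (x *+ n) z.
Proof.
move=> x0 z0 xz; elim: n => [|n IH]; first by rewrite mulr0n => d.
by rewrite mulrS; apply: disjoint_eltsD => //; exact: lg_mulrn_ge0.
Qed.

(** Since [d <= posp x <= x + posp (- x)], the element [posp (- x) - d] still dominates [- x] and 0;
    minimality of [posp (- x)] gives [d <= 0]. *)
Lemma disjoint_posp x : disjoint_elts (posp x) (posp (- x)).
Proof.
move=> d dx dNx.
have xE : posp x <= x + posp (- x).
  apply: posp_le; first by rewrite lg_leDl ?posp_ge0.
  by rewrite -lg_leBlDl sub0r posp_ge.
suff: posp (- x) <= posp (- x) - d by rewrite lg_leBrDr -lg_leBrDl subrr.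
apply: posp_le; last by rewrite lg_subr_ge0.
by rewrite lg_leBrDr addrC lg_leBlDl (le_trans dx).
Qed.

(** For fixed [j], [z - a j] is below every [a i *+ n], hence below 0. No Archimedean property is
    involved, so the lemma also serves in [lexZ G]. *)
Lemma lg_infimum_mulrn n (a : nat -> G) :
  (forall i j, (i <= j)%N -> a j <= a i) -> infimums (range a) 0 ->
  infimums (range (fun i => a i *+ n)) 0.
Proof.
move=> adecr [a0 ainf]; have age0 i : 0 <= a i by apply: a0; exists i.
split=> [_ [i _ <-]|z zl]; first exact: lg_mulrn_ge0.
elim: n z zl => [|n IH] z zl; first by apply: zl; exists 0%N => //; rewrite mulr0n.
have {}IH j : z - a j <= 0.
  apply: IH => _ [i _ <-]; rewrite lg_leBlDl.
  apply: (@le_trans _ _ (a (maxn i j) *+ n.+1)); first by apply: zl; exists (maxn i j).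
  rewrite mulrS lg_leD//; first by apply: adecr; rewrite leq_maxr.
  by apply/lg_leMn/adecr; rewrite leq_maxl.
by apply: ainf => _ [j _ <-]; rewrite -lg_subr_le0.
Qed.

Hypothesis hG : dedekind_sigma_complete G.

Lemma lg_sup_seq (a : nat -> G) : has_ubound (range a) ->
  exists s, supremums (range a) s.
Proof.
move=> ub; apply: hG => //; first by exists (a 0%N), 0%N.
exact: (sub_countable (card_image_le _ _)).

Qed.

(** If [s] is the supremum of the multiples of [x], then [s - x] bounds them as well. *)
Lemma lg_archimedean x u : (forall n, x *+ n <= u) -> x <= 0.
Proof.
move=> xu; have [|s [sub sle]] := @lg_sup_seq (fun n => x *+ n).
  by exists u => _ [n _ <-].
suff: s <= s - x by rewrite lg_leBrDr -lg_leBrDl subrr.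
apply: sle => _ [n _ <-]; rewrite lg_leBrDr -mulrSr.
by apply: sub; exists n.+1.
Qed.

End LGroupOrder.

Arguments posp {G}.
Arguments disjoint_elts {G}.
Arguments disjoint_posp {G} x.

(** * Real-valued states *)

Section States.
Variables (R : realType) (G : lgroupType) (u : G).
Implicit Types x y z : G.

(** The convex subgroup generated by [u], which need not be a strong unit of [G]; states are total
    functions constrained only there. *)
Definition unit_bounded x : Prop := exists K : nat, - (u *+ K) <= x <= u *+ K.

Hypothesis u0 : 0 <= u.

Lemma unit_boundedD x y :
  unit_bounded x -> unit_bounded y -> unit_bounded (x + y).
Proof.
move=> [K /andP[x1 x2]] [L /andP[y1 y2]]; exists (K + L)%N.
by rewrite mulrnDr opprD !lg_leD.
Qed.

Lemma unit_boundedN x : unit_bounded x -> unit_bounded (- x).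
Proof.
by move=> [K /andP[x1 x2]]; exists K; rewrite lg_leN2 x2 -lg_leN2 opprK.
Qed.

Lemma unit_boundedB x y :
  unit_bounded x -> unit_bounded y -> unit_bounded (x - y).
Proof. by move=> bx /unit_boundedN; exact: unit_boundedD. Qed.

Lemma unit_bounded_interval x : 0 <= x <= u -> unit_bounded x.
Proof.
move=> /andP[x0 xu]; exists 1%N; rewrite mulr1n xu (le_trans _ x0)//.
by rewrite lg_oppr_le0.
Qed.

Lemma unit_boundedMn n x : unit_bounded x -> unit_bounded (x *+ n).
Proof.
move=> bx; elim: n => [|n IH]; first by exists 0%N; rewrite !mulr0n oppr0 lexx.
by rewrite mulrS; exact: unit_boundedD.
Qed.

Record is_state (w : G -> R) : Prop := IsState {
  stateD : forall x y, unit_bounded x -> unit_bounded y -> w (x + y) = w x + w y ;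
  state_ge0 : forall x, unit_bounded x -> 0 <= x -> 0 <= w x ;
  state_unit : w u = 1
}.

Section StateTheory.
Variables (w : G -> R) (sw : is_state w).

Lemma state0 : w 0 = 0.
Proof.
have b0 : unit_bounded 0 by apply: unit_bounded_interval; rewrite lexx.
by have := stateD sw b0 b0; rewrite addr0 => /eqP; rewrite -subr_eq subrr => /eqP.
Qed.

Lemma stateN x : unit_bounded x -> w (- x) = - w x.
Proof.
move=> bx; apply/eqP; rewrite -addr_eq0 -stateD// ?addNr ?state0//.
exact: unit_boundedN.
Qed.

Lemma stateB x y : unit_bounded x -> unit_bounded y -> w (x - y) = w x - w y.
Proof.
by move=> bx by_; rewrite stateD ?stateN//; exact: unit_boundedN.
Qed.

Lemma state_le x y : unit_bounded x -> unit_bounded y -> x <= y -> w x <= w y.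
Proof.
move=> bx by_ xy; rewrite -subr_ge0 -stateB// state_ge0 ?lg_subr_ge0//.
exact: unit_boundedB.
Qed.

End StateTheory.

(** * States obtained from total preorders *)

Section Hoelder.
Variable le : G -> G -> Prop.
Hypothesis le_of_le : forall x y, x <= y -> le x y.
Hypothesis le_tr : forall y x z, le x y -> le y z -> le x z.
Hypothesis leD2 : forall z x y, le x y -> le (x + z) (y + z).
Hypothesis le_tot : forall x y, le x y \/ le y x.
Hypothesis le_u : ~ le u 0.

Let leD x y z t : le x y -> le z t -> le (x + z) (y + t).
Proof.
move=> xy zt; apply: (@le_tr (y + z)); first exact: leD2.
by rewrite ![y + _]addrC; exact: leD2.
Qed.

Let leMn n x y : le x y -> le (x *+ n) (y *+ n).
Proof.
move=> xy; elim: n => [|n IH]; first exact: le_of_le.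
by rewrite !mulrS; exact: leD.
Qed.

Let le_mulrz p p' : le (u *~ p) (u *~ p') -> p <= p'.
Proof.
move=> h; rewrite leNgt; apply/negP => pp'; apply: le_u.
have [n nE] : exists n : nat, p - p' = n.+1.
  by exists `|p - p'|.-1%N; lia.
have := leD2 (- (u *~ p')) h; rewrite subrr -mulrzBr nE => h2.
apply: le_tr h2; apply: le_of_le.
by rewrite -{1}[u]mulr1n -pmulrn lg_leMn2.
Qed.

Let le_floor z : unit_bounded z ->
  exists a, le (u *~ a) z /\ le z (u *~ (a + 1)).
Proof.
move=> [K /andP[Kz zK]].
have [i [h1 h2]] : exists i : nat,
    le (u *~ (- K%:Z + i%:Z)) z /\ ~ le (u *~ (- K%:Z + i.+1%:Z)) z.
  apply: contrapT => hn.
  have P i : le (u *~ (- K%:Z + i%:Z)) z.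
    elim: i => [|i IH]; first by rewrite addr0 mulrNz -pmulrn; exact: le_of_le.
    by apply: contrapT => hi; apply: hn; exists i.
  have h := le_tr (P (K + K.+1)%N) (le_of_le zK).
  by move: h; rewrite pmulrn => /le_mulrz; lia.
exists (- K%:Z + i%:Z); split=> //.
have [|h] := le_tot (u *~ (- K%:Z + i.+1%:Z)) z; first by [].
by rewrite -addrA [_%:Z + 1]addrC -intS.
Qed.

Let cut x : set R := [set r | exists p (q : nat),
  [/\ (0 < q)%N, le (u *~ p) (x *+ q) & r = p%:~R / q%:R]].

Let cut_le x K r : x <= u *+ K -> cut x r -> r <= K%:R.
Proof.
move=> xK [p [q [q0 pq ->]]].
rewrite ler_pdivrMr ?ltr0n// -natrM (_ : (K * q)%:R = (K * q)%:Z%:~R)//.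
rewrite ler_int; apply: le_mulrz; apply: le_tr pq _.
by rewrite -pmulrn mulrnA; apply/le_of_le/lg_leMn.
Qed.

Let w x : R := sup (cut x).

Let cut_sup x : unit_bounded x -> has_sup (cut x).
Proof.
move=> [K /andP[Kx xK]]; split; last by exists K%:R => r; exact: cut_le.
exists ((- K%:Z)%:~R / 1%:R), (- K%:Z), 1%N; split=> //.
by rewrite mulrNz -pmulrn mulr1n; exact: le_of_le.
Qed.

Let le_w x r : unit_bounded x -> cut x r -> r <= w x.
Proof. by move=> bx xr; apply: sup_upper_bound => //; exact: cut_sup. Qed.

Let w_le x r : unit_bounded x -> (forall s, cut x s -> s <= r) -> w x <= r.
Proof. by move=> bx h; apply: ge_sup => //; exact: (cut_sup bx).1. Qed.

Let w_state : is_state w.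
Proof.
split=> [x y bx by_|x bx x0|].
- have bxy := unit_boundedD bx by_.
  apply/eqP; rewrite eq_le; apply/andP; split.
    apply: w_le => // r [p [q [q0 pq ->]]].
    apply/ler_addgt0Pr => e e0.
    (* At scale [q * N], [x] and [y] are each rounded to an integer multiple of [u]; the two
       roundings cost 2 in all, that is [2 / (q * N) <= e] after division. *)
    pose N := (Num.truncn (2 / e)).+1.
    have NE : 2 / (q * N)%:R <= e.
      rewrite ler_pdivrMr ?ltr0n ?muln_gt0 ?q0// -ler_pdivrMl//.
      rewrite mulrC (le_trans (ltW (truncnS_gt _)))// ler_nat.
      by rewrite -/N leq_pmull.
    have [a [a1 a2]] := le_floor (unit_boundedMn (q * N) bx).
    have [b [b1 b2]] := le_floor (unit_boundedMn (q * N) by_).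
    have qN0 : (0 < q * N)%N by rewrite muln_gt0 q0.
    have wa : a%:~R / (q * N)%:R <= w x by apply: le_w => //; exists a, (q * N)%N.
    have wb : b%:~R / (q * N)%:R <= w y by apply: le_w => //; exists b, (q * N)%N.
    have pN : p * N%:Z <= a + b + 2.
      apply: le_mulrz; rewrite mulrzA -pmulrn.
      apply: le_tr (leMn N pq) _; rewrite -mulrnA mulrnDl.
      have -> : a + b + 2 = (a + 1) + (b + 1) by lia.
      by rewrite mulrzDr; exact: leD.
    have -> : p%:~R / q%:R = (p * N%:Z)%:~R / (q * N)%:R :> R.
      rewrite intrM natrM -mulf_div divff ?mulr1//.
      by rewrite -[N%:Z%:~R]/(N%:R) pnatr_eq0.
    rewrite (le_trans (_ : _ <= (a + b + 2)%:~R / (q * N)%:R))//.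
      by rewrite ler_pM2r ?invr_gt0 ?ltr0n// ler_int.
    by rewrite 2!intrD 2!mulrDl; apply: lerD; [exact: lerD|exact: NE].
  rewrite -lerBrDr; apply: w_le => // r [p [q [q0 pq ->]]].
  rewrite lerBrDr -lerBrDl; apply: w_le => // s [p' [q' [q'0 pq' ->]]].
  rewrite lerBrDl; apply: le_w => //.
  exists (p * q' + p' * q), (q * q')%N; split; first by rewrite muln_gt0 q0.
    rewrite mulrnDl mulrzDr !mulrzA -!pmulrn.
    by apply: leD; rewrite ?mulrnA; [|rewrite -mulrnA mulnC mulrnA]; exact: leMn.
  rewrite addf_div ?pnatr_eq0 -?lt0n// natrM intrD !intrM.
  by rewrite -![_%:Z%:~R]/(_%:R).
- apply: le_w => //; exists 0, 1%N; split; rewrite ?mul0r// mulr0z mulr1n.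
  exact: le_of_le.
- have bu : unit_bounded u by apply: unit_bounded_interval; rewrite u0 lexx.
  apply/eqP; rewrite eq_le; apply/andP; split.
    by apply: w_le => // s; apply: (@cut_le _ 1%N); rewrite mulr1n.
  by apply: le_w => //; exists 1, 1%N; split; rewrite ?divr1//; exact: le_of_le.
Qed.

(* Hoelder: the Dedekind cut of [x] in the multiples of [u] is additive. *)
Lemma state_of_total_preorder : exists2 w : G -> R, is_state w &
  (forall x P, unit_bounded x -> le (x *+ P.+1) u -> w x <= P.+1%:R^-1) /\
  (forall x P, unit_bounded x -> le u (x *+ P.+1) -> P.+1%:R^-1 <= w x).
Proof.
exists w; first exact: w_state.
split=> x P bx xP; last by apply: le_w => //; exists 1, P.+1; rewrite mul1r.
apply: w_le => // r [p [q [q0 pq ->]]].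
rewrite ler_pdivrMr ?ltr0n// ler_pdivlMl// mulrC.
have : p * P.+1%:Z <= q%:Z.
  apply: le_mulrz; rewrite mulrzA -!pmulrn; apply: le_tr (leMn _ pq) _.
  by rewrite -mulrnA mulnC mulrnA; exact: leMn.
by rewrite -(ler_int R) intrM.
Qed.

End Hoelder.
End States.

(** * Prime ideals avoiding a decreasing sequence *)

Section PrimeIdeal.
Variables (G : lgroupType) (b : nat -> G).
Hypothesis b_ge0 : forall i, 0 <= b i.
Hypothesis b_gt0 : forall i, ~ (b i <= 0).
Hypothesis b_decr : forall i j, (i <= j)%N -> b j <= b i.

(** Membership of 0 is not demanded, so that the union of the empty chain qualifies in Zorn's lemma;
    it is recovered from maximality. *)
Let avoiding (N : set G) := [/\ forall x, N x -> 0 <= x,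
  forall x y, N x -> N y -> N (x + y),
  forall x y, N x -> 0 <= y -> y <= x -> N y & forall i, ~ N (b i)].

(** Primeness comes from maximality: adjoining [x] or [y] to [N] captures some [b i], so a late [b]
    exceeds an element [n + n'] of [N] by something below multiples of both [x] and [y], and
    disjointness makes this excess nonpositive. *)
Lemma prime_ideal_avoiding : exists N : set G,
  [/\ N 0, forall x y, N x -> N y -> N (x + y),
      forall x y, N x -> 0 <= y -> y <= x -> N y, forall i, ~ N (b i) &
      forall x y, 0 <= x -> 0 <= y -> disjoint_elts x y -> N x \/ N y].
Proof.
have [F FP Ftot|N [[Nge ND Nle Nb] Nmax]] := @Zorn_bigcup G avoiding.
  split=> [x [A FA Ax]|x y [A FA Ax] [B FB By]|x y [A FA Ax] y0 yx|i [A FA]].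
  - by have [h _ _ _] := FP _ FA; exact: h.
  - have [AB|BA] := Ftot _ _ FA FB.
      by exists B => //; have [_ h _ _] := FP _ FB; apply: h => //; exact: AB.
    by exists A => //; have [_ h _ _] := FP _ FA; apply: h => //; exact: BA.
  - by exists A => //; have [_ _ h _] := FP _ FA; exact: (h x).
  - by have [_ _ _ h] := FP _ FA; exact: h.
have N0 : N 0.
  apply: contrapT => N0; have NE x : ~ N x.
    by move=> Nx; apply: N0; apply: (Nle x) => //; exact: Nge.
  apply: (Nmax [set 0]); first by split=> [x /NE//|/(_ 0 erefl)].
  split=> [x ->//|x y -> ->|x y -> y0 yx|i h]; first by rewrite addr0.
    by apply/eqP; rewrite eq_le yx.
  by apply: (@b_gt0 i); rewrite h.
exists N; split=> // x y x0 y0 xy.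
pose J z := [set t | 0 <= t /\ exists n K, N n /\ t <= n + z *+ K].
have Jb z : 0 <= z -> ~ N z -> exists i n K, N n /\ b i <= n + z *+ K.
  move=> z0 Nz; apply: contrapT => hn; apply: (Nmax (J z)).
    split=> [t Nt|/(_ z) h].
      by split; [exact: Nge|exists t, 0%N; rewrite mulr0n addr0].
    by apply/Nz/h; split=> //; exists 0, 1%N; rewrite add0r.
  split.
  - by move=> t [].
  - move=> t s [t0 [n [K [Nn tn]]]] [s0 [n' [K' [Nn' sn]]]].
    split; first exact: lg_addr_ge0.
    exists (n + n'), (K + K')%N; split; first exact: ND.
    by rewrite mulrnDr addrACA lg_leD.
  - move=> t s [t0 [n [K [Nn tn]]]] s0 st; split=> //.
    by exists n, K; split=> //; exact: le_trans st tn.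
  - by move=> i [_ [n [K h]]]; apply: hn; exists i, n, K.
apply: contrapT => /not_orP[Nx Ny].
have [i [n [K [Nn bx]]]] := Jb _ x0 Nx.
have [j [n' [K' [Nn' by_]]]] := Jb _ y0 Ny.
apply: (Nb (maxn i j)); apply: (Nle (n + n')) => //; first exact: ND.
rewrite -lg_subr_le0.
have xK : disjoint_elts (x *+ K) (y *+ K').
  apply: disjoint_eltsMn => //; first exact: lg_mulrn_ge0.
  by apply/disjoint_eltsC/disjoint_eltsMn => //; exact: disjoint_eltsC.
apply: xK; rewrite lg_leBlDr addrC.
  apply: (le_trans (b_decr (leq_maxl i j))); apply: (le_trans bx).
  by rewrite lg_leD2r lg_leDl// Nge.
apply: (le_trans (b_decr (leq_maxr i j))); apply: (le_trans by_).
by rewrite lg_leD2r lg_leDr// Nge.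
Qed.

End PrimeIdeal.

(** * Separation of elements by states outside an exceptional set *)

Section Separation.
Variables (R : realType) (G : lgroupType) (hG : dedekind_sigma_complete G).
Variable u : G.
Hypothesis u0 : 0 <= u.

Definition null_seq (a : nat -> G) : Prop :=
  [/\ forall i j, (i <= j)%N -> a j <= a i, infimums (range a) 0 &
      exists K, a 0%N <= u *+ K].

Definition vanishes (w : G -> R) (a : nat -> G) : Prop :=
  forall P, exists n, w (a n) <= P.+1%:R^-1.

Lemma null_seq_bounded a n : null_seq a -> 0 <= a n /\ unit_bounded u (a n).
Proof.
move=> [ad [a0 _] [K aK]]; have an0 : 0 <= a n by apply: a0; exists n.
split=> //; exists K; apply/andP; split; last exact: le_trans (ad _ _ _) aK.
by apply: le_trans an0; rewrite lg_oppr_le0 lg_mulrn_ge0.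
Qed.

Let cond (b : G) := [/\ 0 <= b, ~ (b <= 0) & exists K, b <= u *+ K].

Let step (a : nat -> G) P b : null_seq a -> cond b -> exists b',
  [/\ cond b', b' <= b &
      exists n, disjoint_elts b' (posp (a n *+ P.+1 - u))].
Proof.
move=> na [b0 bn [K bK]]; have [ad a0 _] := na.
have [n hn] : exists n, ~ disjoint_elts b (posp (u - a n *+ P.+1)).
  apply: contrapT => hn.
  have dis n : disjoint_elts b (posp (u - a n *+ P.+1)).
    by apply: contrapT => h; apply: hn; exists n.
  apply: bn; suff: disjoint_elts b (u *+ K) by apply.
  apply/disjoint_eltsC/disjoint_eltsMn => //; apply/disjoint_eltsC => d db du.
  have ddb := posp_le db b0; have ddu := posp_le du u0.
  apply: le_trans (posp_ge d) _.
  have [_ /(_ (posp d))] := lg_infimum_mulrn P.+1 ad a0; apply => _ [n _ <-].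
  set c := posp (u - a n *+ P.+1).
  have cu : c <= u
    by apply: posp_le => //; rewrite lg_gerBl// lg_mulrn_ge0// (null_seq_bounded n na).1.
  (* Two disjoint elements below [u] have their sum below [u]; this yields
     [posp d <= a n *+ P.+1]. *)
  have : c + posp d - u <= 0.
    apply: (dis n); rewrite lg_leBlDl.
      by rewrite lg_leD// (le_trans ddb).
    by rewrite addrC lg_leD.
  rewrite lg_subr_le0 => h.
  have := le_trans (lg_leD (posp_ge (u - a n *+ P.+1)) (lexx (posp d))) h.
  by rewrite addrAC lg_leBlDr lg_leD2l.
have {hn}[d [db dc dn]] : exists d, [/\ d <= b, d <= posp (u - a n *+ P.+1) & ~ d <= 0].
  apply: contrapT => h; apply: hn => d db dc; apply: contrapT => dn.
  by apply: h; exists d.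
exists (posp d); split; last 2 first.
- exact: posp_le.
- exists n; apply: (disjoint_elts_le (posp_le dc (posp_ge0 _))).
  by have := disjoint_posp (u - a n *+ P.+1); rewrite opprB.
split; first exact: posp_ge0.
  by move=> h; apply: dn; exact: le_trans (posp_ge _) h.
by exists K; apply: le_trans bK; exact: posp_le.
Qed.

(* Rasiowa-Sikorski: a decreasing sequence of nonzero positive elements meets
   the countably many requirements, and a prime ideal avoiding it gives a
   totally ordered quotient. *)
Lemma state_separation (a : nat -> nat -> G) (g : G) :
  (forall m, null_seq (a m)) -> unit_bounded u g -> ~ (0 <= g) ->
  exists2 w : G -> R, is_state u w & (forall m, vanishes w (a m)) /\ w g < 0.
Proof.
move=> na bg gn.
(* By the Archimedean property some multiple of [- g] is not below [u]. The positive part of the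
   excess starts the sequence; keeping it out of the ideal forces [w (- g)] to be at least
   [P0.+1%:R^-1]. *)
have [P0 hP0] : exists P, ~ ((- g) *+ P.+1 - u <= 0).
  apply: contrapT => h; apply: gn; rewrite -lg_oppr_le0.
  apply: (lg_archimedean hG (u := u)) => -[|n]; first by rewrite mulr0n.
  by rewrite -lg_subr_le0; apply: contrapT => hn; apply: h; exists n.
have cond0 : cond (posp ((- g) *+ P0.+1 - u)).
  split; first exact: posp_ge0.
    by move=> h; apply: hP0; exact: le_trans (posp_ge _) h.
  have [K /andP[_ gK]] := unit_boundedMn P0.+1 (unit_boundedN bg).
  exists K; apply: posp_le; last exact: lg_mulrn_ge0.
  by rewrite lg_leBlDr (le_trans gK)// lg_leDl.
(* Enumerates all requirements, a pair giving a sequence and a precision; the default only repeats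
   one of them. *)
pose req k : nat * nat := odflt (0, 0)%N (unpickle k).
have /choice[s sP] : forall bk : G * nat, exists b', cond bk.1 ->
    [/\ cond b', b' <= bk.1 & exists n, disjoint_elts b'
       (posp (a (req bk.2).1 n *+ (req bk.2).2.+1 - u))].
  move=> [b k]; have [cb|] := pselect (cond b); last by exists 0.
  by have [b' h] := step (req k).2 (na (req k).1) cb; exists b'.
pose b := fix b k := if k is k'.+1 then s (b k', k') else posp ((- g) *+ P0.+1 - u).
have bc k : cond (b k).
  by elim: k => //= k IH; have [] := sP (b k, k) IH.
have b_decr i j : (i <= j)%N -> b j <= b i.
  move=> /subnK <-; elim: (j - i)%N => //= k IH.
  by have [_ h _] := sP (b (k + i)%N, (k + i)%N) (bc _); apply: le_trans h IH.
have b_ge0 i : 0 <= b i by have [] := bc i.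
have b_gt0 i : ~ (b i <= 0) by have [] := bc i.
have [N [N0 ND Nle Nb Nprime]] := prime_ideal_avoiding b_ge0 b_gt0 b_decr.
have Nb_disj i x : 0 <= x -> disjoint_elts (b i) x -> N x.
  by move=> x0 /(Nprime _ _ (b_ge0 i) x0) [/Nb//|].
(* The order of the quotient by the prime ideal: primeness makes it total, and [u] stays positive
   because [b 0] is below a multiple of [u]. *)
pose le x y := N (posp (x - y)).
have [x y xy|y x z xy yz|z x y xy|x y||w sw [w1 w2]] :=
  @state_of_total_preorder R G u u0 le.
- apply: (Nle 0) => //; first exact: posp_ge0.
  by apply: posp_le => //; rewrite lg_subr_le0.
- apply: (Nle (posp (x - y) + posp (y - z))); first exact: ND.
    exact: posp_ge0.
  apply: posp_le; last by rewrite lg_addr_ge0 ?posp_ge0.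
  by rewrite -[x - z](subrKA y) lg_leD ?posp_ge.
- by rewrite /le opprD addrACA subrr addr0.
- apply: Nprime; rewrite ?posp_ge0//.
  by have := disjoint_posp (x - y); rewrite opprB.
- rewrite /le subr0 posp_id// => Nu; have [_ _ [K bK]] := bc 0%N.
  apply: (Nb 0%N); apply: (Nle (u *+ K)) => //.
  by elim: K {bK} => [|K IH]; rewrite ?mulr0n// mulrS; exact: ND.
exists w => //; split=> [m P|].
  have [_ _ [n]] := sP (b (pickle (m, P)), pickle (m, P)) (bc _).
  rewrite /req /= pickleK /= => dn; exists n.
  apply: w1; first exact: (null_seq_bounded n (na m)).2.
  by apply: (Nb_disj (pickle (m, P)).+1); rewrite ?posp_ge0 //= /req.
have : P0.+1%:R^-1 <= w (- g).
  apply: w2; first exact: unit_boundedN.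
  apply: (Nb_disj 0%N); rewrite ?posp_ge0//=.
  by have := disjoint_posp ((- g) *+ P0.+1 - u); rewrite opprB.
by rewrite (stateN u0)// lerNr => /le_lt_trans; apply; rewrite oppr_lt0 invr_gt0.
Qed.

End Separation.

(** * Measures on the space of paths *)

(* Words record the first bits of a path, the last one at the head. *)
Section Cylinders.
Implicit Types (w : seq bool) (beta : nat -> bool).

Fixpoint initial_word beta m : seq bool :=
  if m is m'.+1 then beta m' :: initial_word beta m' else [::].

Fixpoint cylinder w : set (nat -> bool) :=
  if w is b :: w' then cylinder w' `&` [set beta | beta (size w') = b]
  else setT.

Lemma size_initial_word beta m : size (initial_word beta m) = m.
Proof. by elim: m => //= m ->. Qed.

Lemma cylinderP w beta : cylinder w beta <-> initial_word beta (size w) = w.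
Proof.
elim: w => //= b w [IH1 IH2]; split=> [[/IH1 -> <-]//|[h1 h2]].
by split; [exact: IH2|].
Qed.

Lemma cylinder_initial_word beta m : cylinder (initial_word beta m) beta.
Proof. by apply/cylinderP; rewrite size_initial_word. Qed.

Lemma cylinder_split w :
  cylinder w = cylinder (true :: w) `|` cylinder (false :: w).
Proof.
apply/seteqP; split=> [beta wb|beta [[]//|[]//]].
by case E : (beta (size w)); [left|right].
Qed.

Lemma cylinder_disjoint w :
  cylinder (true :: w) `&` cylinder (false :: w) = set0.
Proof. by apply/seteqP; split=> // beta [[_ /= ->] [_ /=]]. Qed.

Definition cylinders : set_system (nat -> bool) :=
  [set A | A = set0 \/ exists w, A = cylinder w].

Lemma cylinder_sub w w' beta : (size w <= size w')%N ->
  cylinder w beta -> cylinder w' beta -> cylinder w' `<=` cylinder w.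
Proof.
elim: w' => [|b w' IH]; first by case: w.
rewrite leq_eqVlt => /orP[/eqP sw|sw].
  by move=> /cylinderP wE /cylinderP w'E; rewrite -wE sw w'E.
by move=> wb [w'b _] gamma [w'g _]; exact: (IH sw wb w'b).
Qed.

Lemma cylinders_setI : setI_closed cylinders.
Proof.
move=> A B [->|[w ->]]; first by rewrite set0I; left.
move=> [->|[w' ->]]; first by rewrite setI0; left.
have [[beta [wb w'b]]|/set0P/negP/negPn/eqP ->] :=
  pselect (cylinder w `&` cylinder w' !=set0); last by left.
right; have [ww'|/ltnW w'w] := leqP (size w) (size w').
  by exists w'; rewrite setIidr//; exact: cylinder_sub wb w'b.
by exists w; rewrite setIidl//; exact: cylinder_sub w'b wb.
Qed.

Definition path_algebra : set_system (nat -> bool) := <<s cylinders >>.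

Lemma path_algebra_cylinder w : path_algebra (cylinder w).
Proof. by apply: sub_sigma_algebra; right; exists w. Qed.

End Cylinders.

Section VectorMeasure.
Variables (T : Type) (V : Num.POrderedZmodule.type) (A : set_system T).

(** Sigma-additivity is expressed by suprema of increasing sequences, order being the only notion of
    limit in [V]. *)
Record vector_measure (X : set T -> V) : Prop := VectorMeasure {
  vm_ge0 : forall B, A B -> 0 <= X B ;
  vmD : forall B C, A B -> A C -> B `&` C = set0 -> X (B `|` C) = X B + X C ;
  vm_sup : forall B : nat -> set T, (forall i, A (B i)) ->
    (forall i j, (i <= j)%N -> B i `<=` B j) ->
    supremums (range (fun i => X (B i))) (X (\bigcup_i B i))
}.

End VectorMeasure.

(** * Real trees of weights and Lebesgue measure *)

Section RealTree.
Variables (R : realType) (p : seq bool -> R).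
Hypothesis p_ge0 : forall w, 0 <= p w.
Hypothesis pD : forall w, p w = p (true :: w) + p (false :: w).

(** Left end of the interval of length [p w] attached to [w]; the [false] child lies to the left of
    the [true] child. *)
Let a := fix a w := if w is b :: w' then
  (if b then a w' + p (false :: w') else a w') else 0.

Let word (y : R) := fix word m := if m is m'.+1 then
  (a (word m') + p (false :: word m') <= y) :: word m' else [::].

(** The path of the nested intervals that contain [y]; the measure of a set of paths will be the
    Lebesgue measure of its preimage. *)
Let psi (y : R) m := a (word y m) + p (false :: word y m) <= y.

Let initial_psi y m : initial_word (psi y) m = word y m.
Proof. by elim: m => //= m ->. Qed.

Let D := [set y : R | 0 <= y < p [::]].

Let pull (B : set (nat -> bool)) : set R := D `&` [set y | B (psi y)].

Let pull_cylinder w : pull (cylinder w) = [set` `[a w, a w + p w[].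
Proof.
have aw_le v : 0 <= a v /\ a v + p v <= p [::].
  elim: v => [|b v [IH1 IH2]]; first by rewrite /= add0r.
  have := p_ge0 (true :: v); have := p_ge0 (false :: v); have := pD v.
  by case: b => /= *; split; lra.
apply/seteqP; split=> y /=.
  move=> [yD /cylinderP]; rewrite initial_psi => <-; rewrite in_itv /=.
  elim: (size w) => [|m]; first by rewrite /= add0r.
  rewrite /=; have := pD (word y m); move: (word y m) => v pv /andP[v1 v2].
  by have [h|h] := leP (a v + p (false :: v)) y => /=; apply/andP; split; lra.
rewrite in_itv /= => yw; have yD : 0 <= y < p [::].
  by have := aw_le w; move: yw => /andP[? ?] [? ?]; apply/andP; split; lra.
split=> //; apply/cylinderP; rewrite initial_psi.
elim: w yw => [//|b w IH] /=; have := pD w.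
have := p_ge0 (true :: w); have := p_ge0 (false :: w).
case: b => /= pf pt pw /andP[y1 y2].
  rewrite IH; last by apply/andP; split; lra.
  by rewrite y1.
rewrite IH; last by apply/andP; split; lra.
by rewrite leNgt y2.
Qed.

Let mpull B : path_algebra B -> measurable (pull B).
Proof.
have mD : measurable D.
  rewrite (_ : D = [set` `[0, p [::] [ ]); first exact: measurable_itv.
  by apply/seteqP; split=> y /=; rewrite in_itv.
move=> mB; suff /(_ _ mB) : path_algebra `<=` [set B | measurable (pull B)] by [].
apply: smallest_sub => [|_ [->|[w ->]]]; last 2 first.
- by rewrite /= /pull (_ : [set y | _] = set0)// setI0.
- by rewrite /= pull_cylinder; exact: measurable_itv.
split=> /= [|C mC|C mC].
- by rewrite /pull (_ : [set y | _] = set0)// setI0.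
- rewrite (_ : pull _ = D `\` pull C); first exact: measurableD.
  apply/seteqP; split=> y [yD]; first by move=> [_ nC]; split=> // -[_].
  by move=> h; split=> //; split=> // yC; apply: h.
- rewrite (_ : pull _ = \bigcup_i pull (C i)); first exact: bigcup_measurable.
  apply/seteqP; split=> [y [yD [i _ yi]]|y [i _ [yD yi]]]; first by exists i.
  by split=> //; exists i.
Qed.

Let nu B : R := fine (lebesgue_measure (pull B)).

Let nu_fin B : path_algebra B -> lebesgue_measure (pull B) \is a fin_num.
Proof.
move=> mB; rewrite ge0_fin_numE//.
apply: (@le_lt_trans _ _ (lebesgue_measure (pull (cylinder [::])))).
  apply: le_measure; rewrite ?inE; [exact: mpull| |by move=> y []].
  by apply: mpull; exact: path_algebra_cylinder.
by rewrite pull_cylinder lebesgue_measure_itv /=; case: ifP; rewrite ?ltry// -EFinB ltry.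
Qed.

Lemma real_tree_measure : exists nu : set (nat -> bool) -> R,
  vector_measure path_algebra nu /\ forall w, nu (cylinder w) = p w.
Proof.
have nuE B : path_algebra B -> (nu B)%:E = lebesgue_measure (pull B).
  by move=> mB; rewrite /nu fineK// nu_fin.
exists nu; split; last first.
  move=> w; rewrite /nu pull_cylinder lebesgue_measure_itv /= lte_fin.
  case: ltP => [_|h]; first by rewrite -EFinB /= addrAC subrr add0r.
  by have := p_ge0 w; rewrite /=; lra.
split=> [B mB|B C mB mC BC|B mB Bincr].
- by rewrite /nu fine_ge0.
- have mBC : path_algebra (B `|` C).
    exact: (@measurableU _ (g_sigma_algebraType cylinders)).
  apply: EFin_inj; rewrite EFinD !nuE// -measureU; [|exact: mpull..|].
    by rewrite /pull -setIUr.
  rewrite /pull setIACA setIid -[X in _ `&` X]/([set y | (B `&` C) (psi y)]) BC.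
  by rewrite (_ : [set y | _] = set0)// setI0.
- have mU : path_algebra (\bigcup_i B i).
    by apply: (@bigcupT_measurable _ (g_sigma_algebraType cylinders)).
  have le_nu C C' : path_algebra C -> path_algebra C' -> C `<=` C' -> nu C <= nu C'.
    move=> mC mC' CC'; rewrite -lee_fin !nuE//; apply: le_measure; rewrite ?inE.
    - exact: mpull.
    - exact: mpull.
    - by move=> y [yD /CC'].
  split=> [_ [i _ <-]|z zub]; first by apply: le_nu => // x; exists i.
  have cvg := @nondecreasing_cvg_mu _ _ _ lebesgue_measure (fun i => pull (B i)).
  rewrite -lee_fin nuE//.
  have -> : pull (\bigcup_i B i) = \bigcup_i pull (B i).
    apply/seteqP; split=> [y [yD [i _ yi]]|y [i _ [yD yi]]]; first by exists i.
    by split=> //; exists i.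
  have {}cvg := cvg (fun i => mpull (mB i)) (bigcupT_measurable _ (fun i => mpull (mB i))).
  have {}cvg : lebesgue_measure (pull (B i)) @[i --> \oo] -->
      lebesgue_measure (\bigcup_i pull (B i)).
    by apply: cvg => i j ij; apply/subsetPset => y [yD yi]; split=> //; exact: Bincr yi.
  rewrite -(cvg_lim _ cvg)//; apply: lime_le; first by apply/cvg_ex; eexists; exact: cvg.
  by near=> n; rewrite /= -nuE// lee_fin; apply: zub; exists n.
Unshelve. all: by end_near.
Qed.

End RealTree.

Section VectorMeasureTheory.
Variables (T : Type) (V : Num.POrderedZmodule.type) (D : set_system T).
Variable (X : set T -> V).
Hypothesis (mX : vector_measure D X).

Lemma vector_measureB A B : D A -> D B -> D (A `\` B) -> B `<=` A ->
  X (A `\` B) = X A - X B.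
Proof.
move=> mA mB mAB BA; rewrite -[in X A](setDUK BA) (vmD mX)//;
  first by rewrite addrAC subrr add0r.
exact: setDIK.
Qed.

End VectorMeasureTheory.

Lemma vector_measure_le (T : Type) (V : lgroupType) (D : set_system T)
    (X : set T -> V) A B : vector_measure D X ->
  D A -> D B -> D (B `\` A) -> A `<=` B -> X A <= X B.
Proof.
move=> mX mA mB mBA AB; rewrite -lg_subr_ge0 -(vector_measureB mX)//.
exact: (vm_ge0 mX).
Qed.

Lemma path_algebraD A B :
  path_algebra A -> path_algebra B -> path_algebra (A `\` B).
Proof. exact: (@measurableD _ (g_sigma_algebraType cylinders)). Qed.

Lemma path_algebraU A B :
  path_algebra A -> path_algebra B -> path_algebra (A `|` B).
Proof. exact: (@measurableU _ (g_sigma_algebraType cylinders)). Qed.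

Lemma path_algebraI A B :
  path_algebra A -> path_algebra B -> path_algebra (A `&` B).
Proof. exact: (@measurableI _ (g_sigma_algebraType cylinders)). Qed.

Lemma path_algebra_bigcup (A : nat -> set (nat -> bool)) :
  (forall i, path_algebra (A i)) -> path_algebra (\bigcup_i A i).
Proof. exact: (@bigcupT_measurable _ (g_sigma_algebraType cylinders)). Qed.

Lemma path_algebra_bigcap (A : nat -> set (nat -> bool)) :
  (forall i, path_algebra (A i)) -> path_algebra (\bigcap_i A i).
Proof. exact: (@bigcapT_measurable _ (g_sigma_algebraType cylinders)). Qed.

Lemma path_algebraT : path_algebra setT.
Proof. exact: (@measurableT _ (g_sigma_algebraType cylinders)). Qed.

(** * Properties valid at almost every state *)

Section AlmostEveryState.
Variables (R : realType) (G : lgroupType) (hG : dedekind_sigma_complete G).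
Variable u : G.
Hypothesis u0 : 0 <= u.

(* The exceptional states are those at which one of countably many sequences
   decreasing to 0 in [G] fails to converge to 0. *)
Definition almost_every_state (Q : (G -> R) -> Prop) : Prop :=
  exists a : nat -> nat -> G, (forall m, null_seq u (a m)) /\
    forall w, is_state u w -> (forall m, vanishes w (a m)) -> Q w.

Local Notation ae := almost_every_state.

Lemma ae_all (Q : (G -> R) -> Prop) : (forall w, is_state u w -> Q w) -> ae Q.
Proof.
move=> h; exists (fun _ _ => 0); split=> [_|w sw _]; last exact: h.
split=> //; last by exists 0%N.
by split=> [_ [i _ <-]//|z zl]; apply: zl; exists 0%N.
Qed.

Lemma ae_sub (Q Q' : (G -> R) -> Prop) :
  (forall w, is_state u w -> Q w -> Q' w) -> ae Q -> ae Q'.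
Proof.
by move=> QQ' [a [na aQ]]; exists a; split=> // w sw /(aQ _ sw) /(QQ' _ sw).
Qed.

Lemma ae_forall (Q : nat -> (G -> R) -> Prop) :
  (forall i, ae (Q i)) -> ae (fun w => forall i, Q i w).
Proof.
move=> /choice[a aP].
exists (fun k => let: (i, m) := odflt (0, 0)%N (unpickle k) in a i m); split.
  by move=> k; case: (odflt _ _) => i m; have [na _] := aP i.
move=> w sw van i; have [_] := aP i; apply=> // m.
by have := van (pickle (i, m)); rewrite pickleK.
Qed.

Lemma ae_and (Q Q' : (G -> R) -> Prop) : ae Q -> ae Q' -> ae (fun w => Q w /\ Q' w).
Proof.
move=> aQ aQ'; apply: (@ae_sub (fun w => forall i, (if i is 0%N then Q else Q') w)).
  by move=> w _ h; split; [exact: (h 0%N)|exact: (h 1%N)].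
by apply: ae_forall => -[].
Qed.

Lemma ae_vanishes (a : nat -> G) : null_seq u a -> ae (fun w => vanishes w a).
Proof. by move=> na; exists (fun=> a); split=> // w _ /(_ 0%N). Qed.

(** An inequality that fails in [G] is refuted by a state at which all the exceptional sequences
    vanish; discarding the exceptional states therefore loses nothing. *)
Lemma ae_le g h : unit_bounded u g -> unit_bounded u h ->
  ae (fun w => w g <= w h) -> g <= h.
Proof.
move=> bg bh [a [na aQ]]; rewrite -lg_subr_ge0; apply: contrapT => gh.
have [w sw [van]] := state_separation R hG u0 na (unit_boundedB bh bg) gh.
by rewrite (stateB u0 sw)// subr_lt0 ltNge (aQ _ sw van).
Qed.

Lemma ae_eq g h : unit_bounded u g -> unit_bounded u h ->
  ae (fun w => w g = w h) -> g = h.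
Proof.
move=> bg bh e; apply/eqP; rewrite eq_le; apply/andP.
by split; apply: ae_le => //; apply: ae_sub e => w _ ->.
Qed.

End AlmostEveryState.

(** * Trees with weights in a Dedekind sigma-complete l-group *)

Section GroupTree.
Variables (R : realType) (G : lgroupType) (hG : dedekind_sigma_complete G).
Variable p : seq bool -> G.
Hypothesis p_ge0 : forall w, 0 <= p w.
Hypothesis pD : forall w, p w = p (true :: w) + p (false :: w).

Let u := p [::].
Let u0 : 0 <= u. Proof. exact: p_ge0. Qed.
Local Notation ae := (@almost_every_state R G u).

Let p_le v : 0 <= p v <= u.
Proof.
rewrite p_ge0 /=; elim: v => // b v; apply: le_trans; rewrite (pD v).
by case: b; [exact: lg_leDl|exact: lg_leDr].
Qed.

Let bp v : unit_bounded u (p v).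
Proof. by apply: unit_bounded_interval => //; exact: p_le. Qed.

Let nu_exists : exists nu : (G -> R) -> set (nat -> bool) -> R,
  forall w, is_state u w -> vector_measure path_algebra (nu w) /\
    forall v, nu w (cylinder v) = w (p v).
Proof.
suff /choice[nu nuP] : forall w : G -> R, exists nu : set (nat -> bool) -> R,
  is_state u w -> vector_measure path_algebra nu /\
    forall v, nu (cylinder v) = w (p v) by exists nu.
move=> w; have [sw|] := pselect (is_state u w); last by exists (fun=> 0).
have [v|v|nu h] := @real_tree_measure R (w \o p).
- by rewrite /= (state_ge0 sw).
- by rewrite /= pD (stateD sw).
- by exists nu.
Qed.

Let nu := projT1 (cid nu_exists).
Let mnu w (sw : is_state u w) : vector_measure path_algebra (nu w).
Proof. exact: (projT2 (cid nu_exists) w sw).1. Qed.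
Let nu_cylinder w (sw : is_state u w) v : nu w (cylinder v) = w (p v).
Proof. exact: (projT2 (cid nu_exists) w sw).2. Qed.

Let nu_le w A B : is_state u w -> path_algebra A -> path_algebra B ->
  A `<=` B -> nu w A <= nu w B.
Proof.
move=> sw mA mB AB; rewrite -subr_ge0 -(vector_measureB (mnu sw))//.
  by apply: (vm_ge0 (mnu sw)); exact: path_algebraD.
exact: path_algebraD.
Qed.

Let rep g A := 0 <= g <= u /\ ae (fun w => w g = nu w A).

Let rep_le g h A B : path_algebra A -> path_algebra B -> A `<=` B ->
  rep g A -> rep h B -> g <= h.
Proof.
move=> mA mB AB [gu ag] [hu ah].
apply: (@ae_le R _ hG u); [by []|exact: unit_bounded_interval..|].
by apply: ae_sub (ae_and ag ah) => w sw [-> ->]; exact: nu_le.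
Qed.

(** A state may send the supremum [s] strictly above the limit of the [w (g i)]. The gaps [s - g i]
    decrease to 0 in [G], and adjoining them to the exceptional sequences excludes such states. *)
Let rep_bigcup (g : nat -> G) (B : nat -> set (nat -> bool)) :
  (forall i, path_algebra (B i)) -> (forall i j, (i <= j)%N -> B i `<=` B j) ->
  (forall i, rep (g i) (B i)) ->
  exists2 s, supremums (range g) s & rep s (\bigcup_i B i).
Proof.
move=> mB Bi rB; have gi i j : (i <= j)%N -> g i <= g j.
  by move=> ij; apply: rep_le (rB i) (rB j) => //; exact: Bi.
have gu i : 0 <= g i <= u by have [] := rB i.
have [|s [sub sle]] := lg_sup_seq hG (a := g).
  by exists u => _ [i _ <-]; have /andP[] := gu i.
have gs i : g i <= s by apply: sub; exists i.
have su : 0 <= s <= u.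
  have /andP[g0 _] := gu 0%N; rewrite (le_trans g0)//=.
  by apply: sle => _ [i _ <-]; have /andP[] := gu i.
have bs : unit_bounded u s by exact: unit_bounded_interval.
have bg i : unit_bounded u (g i) by exact: unit_bounded_interval.
exists s => //; split=> //.
have ns : null_seq u (fun i => s - g i).
  split=> [i j ij||]; first by rewrite lg_leD2l lg_leN2 gi.
    split=> [_ [i _ <-]|z zl]; first by rewrite lg_subr_ge0.
    suff: s <= s - z by rewrite lg_leBrDr -lg_leBrDl subrr.
    by apply: sle => _ [i _ <-]; rewrite lg_leBrDr -lg_leBrDl; apply: zl; exists i.
  by exists 1%N; rewrite mulr1n lg_leBlDr (le_trans (proj2 (andP su)))// lg_leDl;
    have /andP[] := gu 0%N.
have aB : ae (fun w => forall i, w (g i) = nu w (B i)).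
  by apply: ae_forall => i; have [] := rB i.
apply: ae_sub (ae_and (ae_vanishes R ns) aB) => w sw [van wB].
have [nub nle] := vm_sup (mnu sw) mB Bi.
apply/eqP; rewrite eq_le; apply/andP; split; last first.
  by apply: nle => _ [i _ <-]; rewrite -wB (state_le u0 sw).
apply/ler_addgt0Pr => e e0.
have [i] := van (Num.truncn e^-1); rewrite (stateB u0 sw)// lerBlDr addrC => h.
apply: (le_trans h); rewrite wB lerD//; first by apply: nub; exists i.
by rewrite invf_ple ?posrE// ltW// truncnS_gt.
Qed.

Let rep_exists A : path_algebra A -> exists g, rep g A.
Proof.
move: A; suff : path_algebra `<=` [set A | path_algebra A /\ exists g, rep g A].
  by move=> h A /h [].
apply: lambda_system_subset => //; first exact: cylinders_setI.
  split=> //=.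
  - split; first exact: path_algebraT.
    exists u; split; first by rewrite u0 lexx.
    by apply: ae_all => w sw; rewrite -(nu_cylinder sw [::]).
  - move=> A B BA [mA [g rg]] [mB [h rh]]; have mAB := path_algebraD mA mB.
    split=> //; exists (g - h); have hg := rep_le mB mA BA rh rg.
    move: rg rh => [/[dup] gu /andP[g0 gu'] ag] [/[dup] hu /andP[h0 hu'] ah]; split.
      by rewrite lg_subr_ge0 hg (le_trans _ gu')// lg_gerBl.
    apply: ae_sub (ae_and ag ah) => w sw [wg wh].
    rewrite (vector_measureB (mnu sw))// -wg -wh (stateB u0 sw)//.
      exact: unit_bounded_interval.
    exact: unit_bounded_interval.
  - move=> B Bi h; have mB i : path_algebra (B i) by have [] := h i.
    split; first exact: path_algebra_bigcup.
    have /choice[g rg] : forall i, exists g, rep g (B i) by move=> i; have [] := h i.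
    have [|s _ rs] := rep_bigcup mB _ rg; last by exists s.
    by move=> i j ij; apply/subsetPset/Bi.
move=> _ [->|[v ->]].
  split; first exact: (@measurable0 _ (g_sigma_algebraType cylinders)).
  exists 0; split; first by rewrite lexx.
  apply: ae_all => w sw.
  have m0 := @measurable0 _ (g_sigma_algebraType cylinders).
  have := vector_measureB (mnu sw) m0 m0; rewrite setDv subrr (state0 u0 sw).
  by move=> ->.
split; first exact: path_algebra_cylinder.
exists (p v); split; first exact: p_le.
by apply: ae_all => w sw; rewrite nu_cylinder.
Qed.

Lemma group_tree_measure : exists X : set (nat -> bool) -> G,
  vector_measure path_algebra X /\ forall w, X (cylinder w) = p w.
Proof.
have /choice[X XP] : forall A, exists g, path_algebra A -> rep g A.
  move=> A; have [/rep_exists[g rg]|] := pselect (path_algebra A); last by exists 0.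
  by exists g.
have bX A : path_algebra A -> unit_bounded u (X A).
  by move=> /XP[h _]; exact: unit_bounded_interval.
have uniq A g : path_algebra A -> rep g A -> g = X A.
  move=> mA rg; apply/eqP; rewrite eq_le; apply/andP.
  by split; [apply: rep_le rg (XP _ mA)|apply: rep_le (XP _ mA) rg].
exists X; split; last first.
  move=> w; apply/esym/uniq; first exact: path_algebra_cylinder.
  split; first exact: p_le.
  by apply: ae_all => w' sw'; rewrite nu_cylinder.
split=> [A /XP[/andP[]]//|A B mA mB AB|B mB Bi].
- have mAB := path_algebraU mA mB.
  apply: (@ae_eq R _ hG u u0); rewrite ?bX//; first exact: bX.
    by apply: unit_boundedD; exact: bX.
  have [_ aA] := XP _ mA; have [_ aB] := XP _ mB; have [_ aAB] := XP _ mAB.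
  apply: ae_sub (ae_and (ae_and aA aB) aAB) => w sw [[wA wB] wAB].
  by rewrite wAB (stateD sw) ?bX// ?wA ?wB ?(vmD (mnu sw))//; exact: bX.
- have [s ss rs] := rep_bigcup mB Bi (fun i => XP _ (mB i)).
  by rewrite -(uniq _ _ (path_algebra_bigcup mB) rs).
Qed.

End GroupTree.

(** * The lexicographic product *)

Section LexGroup.
Variable G : lgroupType.
Implicit Types x y z : lexZ G.

Fact lexZ_leD2l z x y : x <= y -> z + x <= z + y.
Proof.
move=> /lexZ_leE h; apply/lexZ_leE => /=; case: h => [h|[-> h]].
  by left; rewrite ltrD2l.
by right; rewrite lg_leD2l.
Qed.

Fact lexZ_join x y : exists z, supremums [set x; y] z.
Proof.
have [xy|yx|xy] := ltgtP x.1 y.1.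
- exists y; split=> [_ [->|->]//|z]; last by apply; right.
  by apply/lexZ_leE; left.
- exists x; split=> [_ [->|->]//|z]; last by apply; left.
  by apply/lexZ_leE; left.
- have [t [tub tle]] := lgroup_join x.2 y.2.
  exists ((x.1, t) : lexZ G); split=> [_ [->|->]|z zub]; apply/lexZ_leE.
  + by right; split=> //; apply: tub; left.
  + by right; split=> //; apply: tub; right.
  + have /lexZ_leE[|[xz xz2]] := zub x (or_introl erefl); first by left.
    have /lexZ_leE[|[yz yz2]] := zub y (or_intror erefl); first by rewrite -xy; left.
    by right; split=> //; apply: tle => _ [->|->].
Qed.

Fact lexZ_meet x y : exists z, infimums [set x; y] z.
Proof.
have [xy|yx|xy] := ltgtP x.1 y.1.
- exists x; split=> [_ [->|->]//|z]; last by apply; left.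
  by apply/lexZ_leE; left.
- exists y; split=> [_ [->|->]//|z]; last by apply; right.
  by apply/lexZ_leE; left.
- have [t [tlb tge]] := lgroup_meet x.2 y.2.
  exists ((x.1, t) : lexZ G); split=> [_ [->|->]|z zlb]; apply/lexZ_leE.
  + by right; split=> //; apply: tlb; left.
  + by right; split=> //; apply: tlb; right.
  + have /lexZ_leE[|[xz xz2]] := zlb x (or_introl erefl); first by left.
    have /lexZ_leE[|[yz yz2]] := zlb y (or_intror erefl); first by rewrite -xy; left.
    by right; split=> //; apply: tge => _ [->|->].
Qed.

HB.instance Definition _ :=
  POrderedZmodule_isLGroup.Build (lexZ G) lexZ_leD2l lexZ_join lexZ_meet.

Lemma lexZ_le1 x y : x <= y -> x.1 <= y.1.
Proof. by move=> /lexZ_leE[/ltW//|[-> _]]. Qed.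

Lemma lexZ_le2 x y : x.1 = y.1 -> x <= y -> x.2 <= y.2.
Proof. by move=> xy /lexZ_leE[|[]//]; rewrite xy ltxx. Qed.

End LexGroup.

(** * Trees with weights in Z lex G *)

Section LexTree.
Variables (R : realType) (G : lgroupType) (hG : dedekind_sigma_complete G).

(* Along each path the values, which decrease, stay bounded below in the level
   where their first coordinate stabilizes. *)
Definition path_bounded (p : seq bool -> lexZ G) : Prop := forall beta,
  exists e M, forall m, (M <= m)%N -> e <= p (initial_word beta m) /\
    e.1 = (p (initial_word beta m)).1.

(** Additivity confines all weights to level 0, a copy of [G]. Suprema formed there remain suprema
    in [lexZ G], as an upper bound outside level 0 lies in a higher level. *)
Let flat_tree (p : seq bool -> lexZ G) : (forall w, 0 <= p w) ->
  (forall w, p w = p (true :: w) + p (false :: w)) -> (p [::]).1 <= 0 ->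
  exists X : set (nat -> bool) -> lexZ G,
    vector_measure path_algebra X /\ forall w, X (cylinder w) = p w.
Proof.
move=> p_ge0 pD p0.
have pl w : p w <= p [::].
  elim: w => // b w; apply: le_trans; rewrite (pD w).
  by case: b; [exact: lg_leDl|exact: lg_leDr].
have pE w : (p w).1 = 0.
  apply/eqP; rewrite eq_le (lexZ_le1 (p_ge0 w)) andbT.
  exact: le_trans (lexZ_le1 (pl w)) p0.
have [w|w|Y [mY YE]] := @group_tree_measure R G hG (fun w => (p w).2).
- by apply: (lexZ_le2 _ (p_ge0 w)); rewrite pE.
- by rewrite [in LHS]pD.
exists (fun A => (0, Y A)); split; last by move=> w; rewrite YE -(pE w); case: (p w).
split=> [A mA|A B mA mB AB|B mB Bi].
- by apply/lexZ_leE; right; split=> //; exact: (vm_ge0 mY).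
- by rewrite (vmD mY).
- have [Yub Yle] := vm_sup mY mB Bi; split=> [_ [i _ <-]|z zub].
    by apply/lexZ_leE; right; split=> //; apply: Yub; exists i.
  have zi i : 0 < z.1 \/ 0 = z.1 /\ Y (B i) <= z.2.
    by have /lexZ_leE := zub _ (ex_intro2 _ _ i I erefl).
  apply/lexZ_leE; have [|[z0 _]] := zi 0%N; first by left.
  right; split=> //; apply: Yle => _ [i _ <-].
  by have [|[]//] := zi i; rewrite -z0 ltxx.
Qed.

(** First coordinates are nonnegative and add up over the two children, so positivity passes to at
    least one child; [true] is preferred. *)
Let positive_path (p : seq bool -> lexZ G) : (forall w, 0 <= p w) ->
  (forall w, p w = p (true :: w) + p (false :: w)) -> 0 < (p [::]).1 ->
  exists beta, forall m, 0 < (p (initial_word beta m)).1.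
Proof.
move=> p_ge0 pD p0.
pose word := fix word m :=
  if m is m'.+1 then (0 < (p (true :: word m')).1) :: word m' else [::].
exists (fun m => 0 < (p (true :: word m)).1).
have wE m : initial_word (fun m => 0 < (p (true :: word m)).1) m = word m.
  by elim: m => //= m ->.
move=> m; rewrite wE; elim: m => //= m; rewrite (pD (word m)) /=.
have := lexZ_le1 (p_ge0 (true :: word m));
rewrite le_eqVlt => /orP[/eqP /= <-|h _]; last by rewrite h.
by rewrite ltxx add0r.
Qed.

Let point_mass (beta : nat -> bool) (e : lexZ G) (A : set (nat -> bool)) :=
  if `[< A beta >] then e else 0.

Let point_massD beta e A B : A `&` B = set0 ->
  point_mass beta e (A `|` B) = point_mass beta e A + point_mass beta e B.
Proof.
move=> AB; rewrite /point_mass asbool_or.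
have [Ab|_] := asboolP (A beta); have [Bb|_] /= := asboolP (B beta);
  rewrite ?addr0 ?add0r//.
by have : (A `&` B) beta by []; rewrite AB.
Qed.

Let point_mass_measure beta e X : 0 <= e -> vector_measure path_algebra X ->
  vector_measure path_algebra (fun A => X A + point_mass beta e A).
Proof.
move=> e0 mX; split=> [A mA|A B mA mB AB|B mB Bi].
- apply: lg_addr_ge0; first exact: (vm_ge0 mX).
  by rewrite /point_mass; case: ifP.
- by rewrite (vmD mX)// point_massD// addrACA.
- have [Xub Xle] := vm_sup mX mB Bi; split=> [_ [i _ <-]|z zub].
    apply: lg_leD; first by apply: Xub; exists i.
    rewrite /point_mass; case: asboolP => [Bib|_]; last by case: ifP.
    by case: asboolP => // -[]; exists i.
  rewrite -lg_leBrDr; apply: Xle => _ [i _ <-]; rewrite lg_leBrDr.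
  rewrite /point_mass; case: asboolP => [[j _ Bjb]|nB].
    have := zub _ (ex_intro2 _ _ (maxn i j) I erefl); apply: le_trans.
    rewrite /point_mass; case: asboolP => [_|[]]; last first.
      by apply: Bi Bjb; rewrite leq_maxr.
    rewrite lg_leD2r; apply: (vector_measure_le mX) (Bi _ _ (leq_maxl i j)) => //.
    exact: path_algebraD.
  have := zub _ (ex_intro2 _ _ i I erefl); rewrite /point_mass addr0.
  by case: asboolP => [Bib|_]; [case: nB; exists i|rewrite addr0].
Qed.

(** Induction on the level of the total weight. The mass [e] need not be the limit along [beta],
    only a lower bound in the right level: what remains on [beta] ends up in level 0, and the total
    level drops by [e.1 > 0]. *)
Lemma lex_tree_measure (p : seq bool -> lexZ G) :
  (forall w, 0 <= p w) -> (forall w, p w = p (true :: w) + p (false :: w)) ->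
  path_bounded p -> exists X : set (nat -> bool) -> lexZ G,
    vector_measure path_algebra X /\ forall w, X (cylinder w) = p w.
Proof.
have [k] := ubnP `|(p [::]).1|%N; elim: k p => // k IH p pk p_ge0 pD pb.
have [p0|p0] := leP (p [::]).1 0; first exact: flat_tree.
have [beta betaP] := positive_path p_ge0 pD p0.
have [e [M eM]] := pb beta.
have p_decr gamma m n : (m <= n)%N ->
    p (initial_word gamma n) <= p (initial_word gamma m).
  move=> /subnK <-; elim: (n - m)%N => //= i; apply: le_trans.
  by rewrite (pD (initial_word gamma (i + m))); case: (gamma _);
    [exact: lg_leDl|exact: lg_leDr].
have e1 : 0 < e.1 by have [_ ->] := eM _ (leqnn M).
have e0 : 0 <= e by apply/lexZ_leE; left.
have ep m : e <= p (initial_word beta m).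
  by have [+ _] := eM _ (leq_maxl M m); move/le_trans; apply;
    apply: p_decr; rewrite leq_maxr.
pose p' w := p w - point_mass beta e (cylinder w).
have [|w|w||X [mX XE]] := IH p'.
- rewrite /p' /point_mass; have p0' := lexZ_le1 (ep 0%N); rewrite /= asboolT//= in p0' *.
  by lia.
- rewrite /p' /point_mass; case: asboolP => [/cylinderP <-|_]; last by rewrite subr0.
  by rewrite lg_subr_ge0.
- rewrite /p' cylinder_split point_massD ?cylinder_disjoint// pD.
  by rewrite opprD addrACA.
(* On [beta] the remainder is bounded below by 0 in level 0; any other path leaves [beta] and from
   then on its weights are unchanged. *)
- move=> gamma; have [eg [Mg egP]] := pb gamma.
  have [->|bg] := pselect (gamma = beta).
    exists (0 : lexZ G), M => m /eM[em1 em2].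
    rewrite /p' /point_mass asboolT; last exact: cylinder_initial_word.
    by rewrite lg_subr_ge0 em1 /= em2 subrr.
  have [i gi] : exists i, gamma i <> beta i.
    by apply: contrapT => h; apply: bg; apply/funext => i;
       apply: contrapT => hi; apply: h; exists i.
  exists eg, (maxn Mg i.+1) => m; rewrite geq_max => /andP[/egP h im].
  rewrite /p' /point_mass asboolF ?subr0// => /cylinderP; rewrite size_initial_word.
  elim: m im {h} => // m IHm; rewrite ltnS leq_eqVlt => /orP[/eqP <- /= [/esym//]|im].
  by move=> [_ /IHm]; apply.
exists (fun A => X A + point_mass beta e A); split; first exact: point_mass_measure.
by move=> w; rewrite XE /p' subrK.
Qed.

End LexTree.

(** * Masses of boxes and of cells *)

Section BoxMass.
Variables (R : realType) (n : nat) (G : lgroupType).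
Variable F : 'rV[R]_n -> lexZ G.
Implicit Types (a b c T : 'I_n -> \bar R) (l : seq 'I_n) (i : 'I_n).

Local Notation V := (lexZ G).

Definition upd (A : Type) (c : 'I_n -> A) i (x : A) : 'I_n -> A :=
  fun j => if j == i then x else c j.

(* [F] extended by 0 to the points having a coordinate -oo; the value at +oo is
   junk. *)
Definition ext_dist c : V :=
  if [forall i, c i != -oo%E] then F (\row_i fine (c i)) else 0.

Fixpoint partial_mass l a b c : V :=
  if l is i :: l' then
    partial_mass l' a b (upd c i (b i)) - partial_mass l' a b (upd c i (a i))
  else ext_dist c.

Definition ninf : 'I_n -> \bar R := fun=> -oo%E.

(** The difference runs over all coordinates, so the starting point is immaterial; [ninf] is
    convenient as it lies below every corner. *)
Definition box_mass a b : V := partial_mass (enum 'I_n) a b ninf.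

Lemma upd_id (A : Type) (c : 'I_n -> A) i : upd c i (c i) = c.
Proof. by apply/funext => j; rewrite /upd; case: eqP => [->|]. Qed.

Lemma upd_upd (A : Type) (c : 'I_n -> A) i x y : upd (upd c i x) i y = upd c i y.
Proof. by apply/funext => j; rewrite /upd; case: eqP. Qed.

Lemma updE (A : Type) (c : 'I_n -> A) i x : upd c i x i = x.
Proof. by rewrite /upd eqxx. Qed.

Lemma partial_mass_ext l a b c a' b' c' :
  (forall i, i \in l -> a i = a' i) -> (forall i, i \in l -> b i = b' i) ->
  (forall i, i \notin l -> c i = c' i) ->
  partial_mass l a b c = partial_mass l a' b' c'.
Proof.
elim: l c c' => [|i l IH] c c' aa bb cc.
  by congr ext_dist; apply/funext => i; exact: cc.
have aa' j : j \in l -> a j = a' j by move=> jl; rewrite aa// in_cons jl orbT.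
have bb' j : j \in l -> b j = b' j by move=> jl; rewrite bb// in_cons jl orbT.
rewrite /= aa ?mem_head// bb ?mem_head//; congr (_ - _); apply: IH => // j jl;
  by rewrite /upd; case: eqP => // /eqP ji; rewrite cc// in_cons negb_or ji.
Qed.

Lemma partial_mass_cut l a b c i x : uniq l -> i \in l ->
  partial_mass l a b c =
  partial_mass l a (upd b i x) c + partial_mass l (upd a i x) b c.
Proof.
elim: l c => //= j l IH c /andP[jl ul]; rewrite in_cons.
have [ij _|ij /= il] := eqVneq i j.
  rewrite -ij {j ij} in jl *.
  have E a' b' c' : a' = upd a i x \/ a' = a -> b' = upd b i x \/ b' = b ->
      partial_mass l a' b' c' = partial_mass l a b c'.
    move=> ha hb; apply: partial_mass_ext => // k kl.
      by case: ha => ->//; rewrite /upd; case: eqP kl jl => // -> ->.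
    by case: hb => ->//; rewrite /upd; case: eqP kl jl => // -> ->.
  rewrite !updE.
  have E1 c' : partial_mass l a (upd b i x) c' = partial_mass l a b c'
    by apply: E; [right|left].
  have E2 c' : partial_mass l (upd a i x) b c' = partial_mass l a b c'
    by apply: E; [left|right].
  by rewrite !E1 !E2 [RHS]addrC subrKA.
rewrite (IH (upd c j (b j)))// (IH (upd c j (a j)))//.
have -> : upd b i x j = b j by rewrite /upd eq_sym (negbTE ij).
have -> : upd a i x j = a j by rewrite /upd eq_sym (negbTE ij).
by rewrite opprD addrACA.
Qed.

Lemma box_mass_cut a b i x :
  box_mass a b = box_mass a (upd b i x) + box_mass (upd a i x) b.
Proof. by apply: partial_mass_cut; rewrite ?enum_uniq ?mem_enum. Qed.

Lemma box_mass_flat a b i : a i = b i -> box_mass a b = 0.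
Proof.
move=> ab; have /eqP := box_mass_cut a b i (a i).
by rewrite upd_id {1}ab upd_id -subr_eq subrr => /eqP.
Qed.

(** Clipping both ends makes the position of [q] irrelevant: when [q] is outside the box, one of the
    two parts is flat. *)
Lemma box_mass_split a b i (q : \bar R) : (a i <= b i)%E ->
  box_mass a b =
  box_mass (upd a i (Order.min (a i) q)) (upd b i (Order.min (b i) q)) +
  box_mass (upd a i (Order.max (a i) q)) (upd b i (Order.max (b i) q)).
Proof.
move=> ab; have [qa|aq] := leP q (a i).
  rewrite (min_idPr (le_trans qa ab)) (max_idPl (le_trans qa ab)) !upd_id.
  by rewrite [X in X + _](box_mass_flat (i := i)) ?updE// add0r.
have [bq|qb] := leP (b i) q.
  by rewrite !upd_id [X in _ + X](box_mass_flat (i := i)) ?updE// addr0.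
by rewrite !upd_id; exact: box_mass_cut.
Qed.

Lemma ext_dist_ninf c i : c i = -oo%E -> ext_dist c = 0.
Proof.
by move=> ci; rewrite /ext_dist; case: forallP => // /(_ i); rewrite ci eqxx.
Qed.

Lemma box_mass_ninf b : box_mass ninf b = ext_dist b.
Proof.
have H l c : uniq l ->
    partial_mass l ninf b c = ext_dist (fun i => if i \in l then b i else c i).
  elim: l c => [|i l IH] c /=; first by move=> _; congr ext_dist; apply/funext.
  move=> /andP[il ul]; rewrite !IH// [X in _ - X](ext_dist_ninf (i := i)); last first.
    by rewrite (negbTE il) updE.
  rewrite subr0; congr ext_dist; apply/funext => j; rewrite in_cons /upd.
  by have [->|] := eqVneq j i => //=; rewrite (negbTE il).
rewrite /box_mass H ?enum_uniq//; congr ext_dist.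
by apply/funext => i; rewrite mem_enum.
Qed.

Lemma iter_diff_partial_mass l (a b : 'I_n -> R) (t : 'rV[R]_n) :
  foldr (fun i H => diff_coord i (a i) (b i) H) F l t =
  partial_mass l (EFin \o a) (EFin \o b) (fun i => (t 0 i)%:E).
Proof.
elim: l t => [|i l IH] t /=.
  rewrite /ext_dist; case: forallP => [_|[]//].
  by congr F; apply/rowP => i; rewrite mxE.
rewrite {1}/diff_coord !IH; congr (_ - _); congr partial_mass;
  by apply/funext => j; rewrite mxE /upd; case: ifP.
Qed.

(** What is retained of a spectral resolution once its values are read in [lexZ G]; in [dist_low],
    [z] ranges over the whole group and not only over the interval. *)
Record distribution : Prop := Distribution {
  dist_ge0 : forall t, 0 <= F t ;
  dist_mono : forall s t, lev s t -> F s <= F t ;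
  dist_low : forall (s : 'rV[R]_n) i z,
    (forall r, z <= F (subst_coord s i r)) -> z <= 0 ;
  dist_vol : forall a b : 'I_n -> R, (forall i, a i <= b i) ->
    forall t, 0 <= iter_diff a b F t
}.

Hypothesis dF : distribution.
Let F_ge0 := dist_ge0 dF.
Let F_mono := dist_mono dF.
Let F_low := dist_low dF.
Let F_vol := dist_vol dF.

Lemma ext_dist_ge0 c : 0 <= ext_dist c.
Proof. by rewrite /ext_dist; case: ifP. Qed.

Definition finite_point c := forall i, c i \is a fin_num.

Lemma ext_dist_finite c : finite_point c -> ext_dist c = F (\row_i fine (c i)).
Proof.
move=> fc; rewrite /ext_dist; case: forallP => // -[] i.
by have := fc i; rewrite fin_numE => /andP[].
Qed.

Lemma ext_dist_mono c T : finite_point T -> (forall i, c i <= T i)%E ->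
  ext_dist c <= ext_dist T.
Proof.
move=> fT cT; rewrite {1}/ext_dist; case: forallP => [h|_]; last exact: ext_dist_ge0.
rewrite ext_dist_finite//; apply: F_mono => i; rewrite !mxE; apply: fine_le => //.
rewrite fin_numE h /= -ltey; apply: (le_lt_trans (cT i)).
by rewrite ltey; have := fT i; rewrite fin_numE => /andP[].
Qed.

Lemma partial_mass_bound l a b c T : finite_point T ->
  (forall i, a i <= T i)%E -> (forall i, b i <= T i)%E -> (forall i, c i <= T i)%E ->
  - (ext_dist T *+ 2 ^ size l) <= partial_mass l a b c <= ext_dist T *+ 2 ^ size l.
Proof.
move=> fT aT bT; elim: l c => [|i l IH] c cT /=.
  rewrite expn0 mulr1n ext_dist_mono// andbT (le_trans _ (ext_dist_ge0 c))//.
  by rewrite lg_oppr_le0 ext_dist_ge0.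
have updT x : (x <= T i)%E -> forall j, (upd c i x j <= T j)%E.
  by move=> xT j; rewrite /upd; case: eqP => [->|].
have /andP[b1 b2] := IH _ (updT _ (bT i)).
have /andP[a1 a2] := IH _ (updT _ (aT i)).
rewrite expnS mul2n -addnn mulrnDr opprD !lg_leD//.
  by rewrite -lg_leN2 opprK.
by rewrite lg_leN2.
Qed.

Lemma box_mass_bound a b T : finite_point T ->
  (forall i, a i <= T i)%E -> (forall i, b i <= T i)%E ->
  - (ext_dist T *+ 2 ^ n) <= box_mass a b <= ext_dist T *+ 2 ^ n.
Proof.
move=> fT aT bT; have := partial_mass_bound (enum 'I_n) fT aT bT (c := ninf).
by rewrite size_enum_ord; apply => i; rewrite leNye.
Qed.

(** Induction on the number of infinite coordinates of [a]. Cutting at [b i - m] leaves an upper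
    part with one of them fewer, and a lower part whose absolute value is at most [2 ^ n] times a
    value of [F] that decreases to 0 as [m] grows. *)
Lemma box_mass_ge0 a b : finite_point b -> (forall i, a i <= b i)%E ->
  0 <= box_mass a b.
Proof.
move=> fb; have [k] := ubnP #|[set i | a i == -oo%E]|%SET.
elim: k a b fb => // k IH a b fb ak ab.
have [/forallP afin|/forallPn[i]] := boolP [forall i, a i \is a fin_num].
  have := @F_vol (fine \o a) (fine \o b) _ 0.
  rewrite /iter_diff iter_diff_partial_mass.
  rewrite (_ : partial_mass _ _ _ _ = box_mass a b); last first.
    apply: partial_mass_ext => i; rewrite ?mem_enum//= => _; rewrite fineK//.
  by apply => i; apply: fine_le.
move=> ai; have {}ai : a i = -oo%E.
  have := le_lt_trans (ab i) _; have := fb i; rewrite fin_numE -ltey => /andP[_ h] /(_ _ h).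
  by rewrite ltey => h'; move: ai; rewrite fin_numE h' andbT negbK => /eqP.
pose t : 'rV[R]_n := \row_j fine (b j).
pose h (m : nat) := F (subst_coord t i (fine (b i) - m%:R)).
have h_decr m m' : (m <= m')%N -> h m' <= h m.
  move=> mm; apply: F_mono => j; rewrite !mxE; case: eqP => // _.
  by rewrite lerD2l lerN2 ler_nat.
have h_inf : infimums (range h) 0.
  split=> [_ [m _ <-]|z zl]; first exact: F_ge0.
  apply: (F_low (s := t) (i := i)) => r.
  pose N := (Num.truncn (fine (b i) - r)).+1; have hm : z <= h N by apply: zl; exists N.
  apply: (le_trans hm); apply: F_mono => j; rewrite !mxE; case: eqP => // _.
  by rewrite lerBlDr -lerBlDl ltW// truncnS_gt.
have [_ hle] := lg_infimum_mulrn (2 ^ n) h_decr h_inf.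
rewrite -lg_oppr_le0; apply: hle => _ [m _ <-].
have bmE : (b i = (fine (b i))%:E) by rewrite fineK.
set q : \bar R := (fine (b i) - m%:R)%:E.
have qb : (q <= b i)%E by rewrite bmE lee_fin lerBlDr lerDl.
have fbq : finite_point (upd b i q) by move=> j; rewrite /upd; case: eqP.
rewrite (box_mass_cut a b i q) opprD (le_trans (lg_gerBl _ _))//.
  apply: IH => // [|j]; last by rewrite /upd; case: eqP => [->|].
  rewrite ltnS in ak; apply: leq_trans ak; apply: proper_card.
  apply/properP; split; last by exists i; rewrite inE ?ai// updE.
  by apply/fintype.subsetP => j; rewrite !inE /upd; case: (j == i).
have abq j : (a j <= upd b i q j)%E.
  by rewrite /upd; case: eqP => // ->; rewrite ai leNye.
have /andP[+ _] := box_mass_bound fbq abq (fun=> lexx _).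
rewrite -lg_leN2 opprK => /le_trans; apply; apply: lg_leMn.
rewrite ext_dist_finite// /h; apply: F_mono => j; rewrite !mxE /upd.
by case: eqP.
Qed.

(** One coordinate is trimmed at a time, and the slabs cut off have nonnegative mass. *)
Lemma box_mass_sub a b a' b' : finite_point b -> finite_point b' ->
  (forall i, a i <= a' i)%E -> (forall i, a' i <= b' i)%E -> (forall i, b' i <= b i)%E ->
  box_mass a' b' <= box_mass a b.
Proof.
move=> fb fb' aa ab bb.
pose a_ l i := if i \in l then a' i else a i.
pose b_ l i := if i \in l then b' i else b i.
have aE l i : a_ (i :: l) = upd (a_ l) i (a' i).
  by apply/funext => j; rewrite /a_ /upd in_cons; case: eqP => // ->.
have bE l i : b_ (i :: l) = upd (b_ l) i (b' i).
  by apply/funext => j; rewrite /b_ /upd in_cons; case: eqP => // ->.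
have fb_ l : finite_point (b_ l) by move=> i; rewrite /b_; case: ifP.
have H l : box_mass (a_ l) (b_ l) <= box_mass a b.
  elim: l => [|i l]; first by rewrite lexx.
  have fbl := fb_ l; apply: le_trans; rewrite aE bE.
  have ala j : (a_ l j <= a' j)%E by rewrite /a_; case: ifP.
  have blb j : (b' j <= b_ l j)%E by rewrite /b_; case: ifP.
  have alb j : (a_ l j <= b_ l j)%E by apply: le_trans (blb j); exact: le_trans (ab j).
  rewrite (box_mass_cut _ (b_ l) i (b' i)) (le_trans _ (lg_leDl _ _))//; last first.
    apply: box_mass_ge0 => // j; rewrite /upd; case: eqP => // ->; exact: blb.
  rewrite (box_mass_cut (a_ l) _ i (a' i)) (le_trans _ (lg_leDr _ _))//.
  (* The slab cut off at the bottom has [a' i] as its upper end, which [box_mass_ge0] requires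
     finite; at -oo the slab is flat. *)
  have [a'i|a'i] := eqVneq (a' i) -oo%E.
    rewrite (box_mass_flat (i := i)) ?updE// a'i.
    by apply/eqP; rewrite -leeNy_eq -a'i.
  apply: box_mass_ge0 => j; rewrite /upd; case: (j =P i) => [e|_] //; rewrite ?e//.
  rewrite fin_numE a'i /= -ltey; apply: (le_lt_trans (ab i)).
  by have := fb' i; rewrite fin_numE -ltey => /andP[].
have := H (enum 'I_n); congr (box_mass _ _ <= _);
  by apply/funext => i; rewrite /a_ /b_ mem_enum.
Qed.

Lemma box_mass_slice a b T i : finite_point b -> finite_point T ->
  (forall j, a j <= b j)%E -> (forall j, b j <= T j)%E ->
  box_mass a b <= ext_dist (upd T i (b i)) - ext_dist (upd T i (a i)).
Proof.
move=> fb fT ab bT.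
have -> : ext_dist (upd T i (b i)) - ext_dist (upd T i (a i)) =
    box_mass (upd ninf i (a i)) (upd T i (b i)).
  rewrite -!box_mass_ninf (box_mass_cut ninf (upd T i (b i)) i (a i)) upd_upd.
  by rewrite addrAC subrr add0r.
apply: box_mass_sub => // j; rewrite /upd; case: (j =P i) => [e|_];
  by rewrite ?e ?leNye.
Qed.

End BoxMass.

(** * Suprema of sequences whose level stabilizes *)

Section Suprema.

Lemma supremums_unique (d : Order.disp_t) (V : porderType d) (A : set V) x y :
  supremums A x -> supremums A y -> x = y.
Proof.
move=> [xub xle] [yub yle]; apply/eqP; rewrite eq_le; apply/andP.
by split; [exact: xle|exact: yle].
Qed.

Lemma supremumsD (V : lgroupType) (h h' : nat -> V) (s s' : V) :
  (forall i j, (i <= j)%N -> h i <= h j) ->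
  (forall i j, (i <= j)%N -> h' i <= h' j) ->
  supremums (range h) s -> supremums (range h') s' ->
  supremums (range (fun i => h i + h' i)) (s + s').
Proof.
move=> hi hi' [sub sle] [sub' sle']; split=> [_ [i _ <-]|z zub].
  by apply: lg_leD; [apply: sub; exists i|apply: sub'; exists i].
rewrite -lg_leBrDr; apply: sle => _ [i _ <-]; rewrite lg_leBrDr -lg_leBrDl.
apply: sle' => _ [j _ <-]; rewrite lg_leBrDl.
have := zub _ (ex_intro2 _ _ (maxn i j) I erefl); apply: le_trans.
by rewrite lg_leD ?hi ?hi' ?leq_maxl ?leq_maxr.
Qed.

Lemma int_nondecreasing_stable (u : nat -> int) (K : int) :
  (forall i j, (i <= j)%N -> u i <= u j) -> (forall i, u i <= K) ->
  exists N, forall m, (N <= m)%N -> u m = u N.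
Proof.
have [k] := ubnP `|K - u 0%N|%N; elim: k u => // k IH u uk ui uK.
have [h|h] := pselect (forall m, u m = u 0%N); first by exists 0%N => m _; exact: h.
have [m hm] : exists m, u m <> u 0%N.
  by apply: contrapT => hn; apply: h => m; apply: contrapT => hm; apply: hn; exists m.
have [||i|N NP] := IH (fun i => u (m + i)%N).
- have := ui 0%N m (leq0n m); have := uK m; have := uK 0%N; rewrite addn0; lia.
- by move=> i j ij; apply: ui; rewrite leq_add2l.
- exact: uK.
exists (m + N)%N => i Ni; have -> : i = (m + (i - m))%N by lia.
by apply: NP; lia.
Qed.

Lemma int_nonincreasing_stable (u : nat -> int) :
  (forall i j, (i <= j)%N -> u j <= u i) -> (forall i, 0 <= u i) ->
  exists N, forall m, (N <= m)%N -> u m = u N.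
Proof.
move=> ui u0; have [||N NP] := @int_nondecreasing_stable (fun i => - u i) 0.
- by move=> i j /ui; rewrite lerN2.
- by move=> i; rewrite oppr_le0.
- by exists N => m /NP /oppr_inj.
Qed.

Variables (G : lgroupType) (hG : dedekind_sigma_complete G).
Implicit Type h : nat -> lexZ G.

(** From [N] on the sequence is bounded inside one copy of [G], where Dedekind sigma-completeness
    provides the supremum. *)
Definition stable_from (N : nat) h : Prop :=
  (forall i j, (i <= j)%N -> h i <= h j) /\
  exists e, forall m, (N <= m)%N -> h m <= e /\ (h m).1 = e.1.

Lemma stable_from_sup N h : stable_from N h ->
  exists2 s, supremums (range h) s & forall m, (N <= m)%N -> (h m).1 = s.1.
Proof.
move=> [hi [e eP]]; have [|t [tub tle]] := lg_sup_seq hG (a := fun m => (h (N + m)%N).2).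
  exists e.2 => _ [m _ <-]; have [hm he] := eP (N + m)%N (leq_addr _ _).
  exact: lexZ_le2.
exists ((e.1, t) : lexZ G); last by move=> m /eP[].
have hN m : h (N + m)%N <= ((e.1, t) : lexZ G).
  have [_ he] := eP (N + m)%N (leq_addr _ _).
  by apply/lexZ_leE; right; split=> //; apply: tub; exists m.
split=> [_ [m _ <-]|z zub].
  by apply: le_trans (hN m); apply: hi; rewrite leq_addl.
have hz m : e.1 < z.1 \/ e.1 = z.1 /\ (h (N + m)%N).2 <= z.2.
  have [_ <-] := eP (N + m)%N (leq_addr _ _).
  by apply/lexZ_leE/zub; exists (N + m)%N.
apply/lexZ_leE; have [|[z1 _]] := hz 0%N; first by left.
right; split=> //; apply: tle => _ [m _ <-].
by have [|[]//] := hz m; rewrite z1 ltxx.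
Qed.

(** Two nondecreasing first coordinates with a constant sum are constant. Stability thus passes from
    a cell to its two parts with the same [N]. *)
Lemma stable_from_addl N h h' : stable_from N (fun i => h i + h' i) ->
  (forall i j, (i <= j)%N -> h i <= h j) ->
  (forall i j, (i <= j)%N -> h' i <= h' j) -> stable_from N h.
Proof.
move=> [_ [e eP]] hi hi'; split=> //; exists (e - h' N) => m Nm.
have [hm em] := eP m Nm; have [_ eN] := eP N (leqnn N).
split; first by rewrite lg_leBrDr; apply: le_trans hm; rewrite lg_leD2l hi'.
have := lexZ_le1 (hi _ _ Nm); have := lexZ_le1 (hi' _ _ Nm).
by rewrite /= -em in eN *; move: em eN => /=; lia.
Qed.

End Suprema.

(** * Cells cut by rational inequalities and their weights *)

Section Cells.
Variables (R : realType) (n : nat) (G : lgroupType).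
Hypothesis hG : dedekind_sigma_complete G.
Variables (F : 'rV[R]_n -> lexZ G) (dF : distribution F).
(* Bit [m] of a path answers the question whether [t 0 (qi m) < qr m]. *)
Variables (qi : nat -> 'I_n) (qr : nat -> R).
Implicit Types (w : seq bool) (T : 'rV[R]_n) (x : 'I_n -> \bar R).

(** [true] keeps the part below [q], [false] the part from [q] on. Being monotone in [y], it turns
    contradictory answers into flat boxes, never into reversed ones. *)
Definition clip (b : bool) (q y : \bar R) : \bar R :=
  if b then Order.min y q else Order.max y q.

Fixpoint clip_word w x : 'I_n -> \bar R :=
  if w is b :: w' then
    let y := clip_word w' x in let m := size w' in
    upd y (qi m) (clip b (qr m)%:E (y (qi m)))
  else x.

Definition corner T : 'I_n -> \bar R := fun i => (T 0 i)%:E.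

(* The mass of the part below [T] of the cell described by [w]. *)
Definition cell_mass T w : lexZ G :=
  box_mass F (clip_word w (@ninf R n)) (clip_word w (corner T)).

Lemma clip_mono b q y z : (y <= z)%E -> (clip b q y <= clip b q z)%E.
Proof.
move=> yz; case: b; rewrite /clip; first by rewrite le_min2.
by rewrite le_max2.
Qed.

Lemma clip_word_mono w x y : (forall i, x i <= y i)%E ->
  forall i, (clip_word w x i <= clip_word w y i)%E.
Proof.
move=> xy; elim: w => //= b w IH i; rewrite /upd; case: eqP => // _.
exact: clip_mono.
Qed.

Lemma clip_word_finite w x : finite_point x -> finite_point (clip_word w x).
Proof.
move=> fx; elim: w => //= b w IH i; rewrite /upd; case: eqP => // _.
by have := IH (qi (size w)); case: b; rewrite /clip; case: leP.
Qed.

Lemma cell_mass_nil T : cell_mass T [::] = F T.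
Proof.
rewrite /cell_mass /= box_mass_ninf ext_dist_finite//.
by congr F; apply/rowP => i; rewrite mxE.
Qed.

Let clip_le w T i : (clip_word w (@ninf R n) i <= clip_word w (corner T) i)%E.
Proof. by apply: clip_word_mono => j; rewrite leNye. Qed.

Lemma cell_mass_ge0 T w : 0 <= cell_mass T w.
Proof. by apply: box_mass_ge0 => //; exact: clip_word_finite. Qed.

Lemma cell_massD T w :
  cell_mass T w = cell_mass T (true :: w) + cell_mass T (false :: w).
Proof. by rewrite /cell_mass -(@box_mass_split _ _ _ _ _ _ (qi (size w)))//. Qed.

Lemma cell_mass_mono T T' w : lev T T' -> cell_mass T w <= cell_mass T' w.
Proof.
move=> TT'; apply: box_mass_sub => //; do ?exact: clip_word_finite.
by apply: clip_word_mono => i; rewrite lee_fin.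
Qed.

Definition diag_pt (N : nat) : 'rV[R]_n := \row_i N%:R.

Lemma lev_diag_pt T : exists N, lev T (diag_pt N).
Proof.
exists (\max_i (Num.truncn (T ord0 i)).+1)%N => i; rewrite mxE.
apply: le_trans (ltW (truncnS_gt _)) _; rewrite ler_nat.
exact: (leq_bigmax_cond (F := fun i => (Num.truncn (T ord0 i)).+1)).
Qed.

Lemma lev_diag_mono i j : (i <= j)%N -> lev (diag_pt i) (diag_pt j).
Proof. by move=> ij k; rewrite !mxE ler_nat. Qed.

Variable N0 : nat.
Hypothesis F_stable : stable_from N0 (fun N => F (diag_pt N)).

Lemma cell_mass_stable w : stable_from N0 (fun N => cell_mass (diag_pt N) w).
Proof.
have mono v i j : (i <= j)%N -> cell_mass (diag_pt i) v <= cell_mass (diag_pt j) v.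
  by move=> ij; apply/cell_mass_mono/lev_diag_mono.
elim: w => [|b w IH]; first by under eq_fun do rewrite cell_mass_nil.
apply: (@stable_from_addl _ _ _ (fun N => cell_mass (diag_pt N) (~~ b :: w)));
  [|exact: mono|exact: mono].
rewrite [X in stable_from _ X](_ : _ = fun N => cell_mass (diag_pt N) w)//.
by apply/funext => N; rewrite (cell_massD _ w); case: b => //; rewrite addrC.
Qed.

Definition cell_limit w : lexZ G :=
  projT1 (cid2 (stable_from_sup hG (cell_mass_stable w))).

Lemma cell_limit_sup w :
  supremums (range (fun N => cell_mass (diag_pt N) w)) (cell_limit w).
Proof. by rewrite /cell_limit; case: cid2. Qed.

Lemma cell_limit_level w N : (N0 <= N)%N ->
  (cell_mass (diag_pt N) w).1 = (cell_limit w).1.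
Proof. by rewrite /cell_limit; case: cid2 => s sP /= + Nm; apply. Qed.

Lemma cell_mass_le_limit T w : cell_mass T w <= cell_limit w.
Proof.
have [N TN] := lev_diag_pt T; apply: le_trans (cell_mass_mono w TN) _.
by have [+ _] := cell_limit_sup w; apply; exists N.
Qed.

Lemma cell_limit_ge0 w : 0 <= cell_limit w.
Proof. exact: le_trans (cell_mass_ge0 0 w) (cell_mass_le_limit 0 w). Qed.

Lemma cell_limitD w :
  cell_limit w = cell_limit (true :: w) + cell_limit (false :: w).
Proof.
apply: supremums_unique (cell_limit_sup w) _.
rewrite (_ : (fun _ => _) = fun N => cell_mass (diag_pt N) (true :: w) +
  cell_mass (diag_pt N) (false :: w)); last by apply/funext => N; rewrite cell_massD.
by apply: supremumsD; try exact: cell_limit_sup;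
  move=> i j ij; apply/cell_mass_mono/lev_diag_mono.
Qed.

End Cells.

(** * Spectral resolutions *)

Section LexLevel.
Variable G : lgroupType.
Implicit Types (S : set (lexZ G)) (s z : lexZ G).

(** A supremum is attained in level if not in value. Conditions (ii) to (iv) thereby give points at
    which the first coordinate of [F] already has its limit value. *)
Lemma lexZ_lub_level S s : (forall x, S x -> x <= s) ->
  (forall z, (forall x, S x -> x <= z) -> s <= z) ->
  exists2 x, S x & x.1 = s.1.
Proof.
move=> sub sle; apply: contrapT => hn.
have S1 x : S x -> x.1 < s.1.
  move=> Sx; rewrite lt_neqAle (lexZ_le1 (sub _ Sx)) andbT; apply/negP => /eqP xs.
  by apply: hn; exists x.
(* a least upper bound lying in a strictly higher level forces [G] trivial *)
have G0 (g : G) : g <= 0.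
  have h : s <= ((s.1, s.2 - g) : lexZ G).
    by apply: sle => x /S1 xs; apply/lexZ_leE; left.
  by have := lexZ_le2 _ h => /(_ erefl) /=; rewrite lg_leBrDr -lg_leBrDl subrr.
have h : s <= ((s.1 - 1, 0) : lexZ G).
  apply: sle => x /S1 xs; apply/lexZ_leE => /=.
  have : x.1 <= s.1 - 1 by lia.
  by rewrite le_eqVlt => /orP[/eqP|]; [right|left].
by have := lexZ_le1 h => /=; lia.
Qed.

Lemma lexZ_glb_level S s : (forall x, S x -> s <= x) ->
  (forall z, (forall x, S x -> z <= x) -> z <= s) ->
  exists2 x, S x & x.1 = s.1.
Proof.
move=> slb sge; have [x|z zub|x Sx xs] := @lexZ_lub_level [set x | S (- x)] (- s).
- by move=> /slb; rewrite -lg_leN2 opprK.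
- by rewrite -lg_leN2 opprK; apply: sge => x Sx; rewrite -lg_leN2 opprK zub //= opprK.
- by exists (- x) => //=; rewrite xs opprK.
Qed.

End LexLevel.

Section SpectralResolution.
Variables (R : realType) (n k : nat) (G : lgroupType).
Variables (F : 'rV[R]_n -> gammaZ G k) (hF : spectral_resolution F).
Implicit Types (s t : 'rV[R]_n) (z : lexZ G).

Let H t : lexZ G := val (F t).

Let one : lexZ G := (k%:Z, 0).

Lemma gammaZ_ge0 (x : gammaZ G k) : 0 <= val x.
Proof. by have /andP[] := valP x. Qed.

Lemma gammaZ_le1 (x : gammaZ G k) : val x <= one.
Proof. by have /andP[] := valP x. Qed.

(** Suprema in the interval are suprema in the whole group: [val x - posp (val x - z)] is the meet
    of [val x] and [z], it bounds [S], and it belongs to the interval. *)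
Lemma gammaZ_supremum (S : set (gammaZ G k)) x z : S !=set0 ->
  supremums S x -> (forall y, S y -> val y <= z) -> val x <= z.
Proof.
move=> [y0 Sy0] [xub xle] zub; pose y := posp (val x - z).
have Sle v : S v -> val v <= val x - y.
  move=> Sv; rewrite lg_leBrDr -lg_leBrDl; apply: posp_le.
    by rewrite lg_leB// zub.
  by rewrite lg_subr_ge0; exact: xub.
have h : 0 <= val x - y <= one.
  rewrite (le_trans (gammaZ_ge0 y0) (Sle _ Sy0)) /=.
  by rewrite (le_trans (lg_gerBl _ (posp_ge0 _)))// gammaZ_le1.
have : x <= (exist _ (val x - y) h : gammaZ G k) by apply: xle => v /Sle.
rewrite -[_ <= _]/(val x <= val x - y) lg_leBrDr -lg_leBrDl subrr => y0'.
by rewrite -lg_subr_le0; exact: le_trans (posp_ge _) y0'.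
Qed.

Lemma gammaZ_infimum0 (S : set (gammaZ G k)) z : S !=set0 ->
  infimums S gamma0 -> (forall y, S y -> z <= val y) -> z <= 0.
Proof.
move=> [y0 Sy0] [_ xge] zlb.
have Sle v : S v -> posp z <= val v.
  by move=> Sv; apply: posp_le; [exact: zlb|exact: gammaZ_ge0].
have h : 0 <= posp z <= one.
  by rewrite posp_ge0 (le_trans (Sle _ Sy0))// gammaZ_le1.
have : (exist _ (posp z) h : gammaZ G k) <= gamma0 by apply: xge => v /Sle.
by rewrite -[_ <= _]/(posp z <= 0); apply: le_trans; exact: posp_ge.
Qed.

Lemma ltv_exists t : exists s, ltv s t.
Proof.
by exists (\row_i (t 0 i - 1)) => i; rewrite mxE ltrBlDr ltrDl.
Qed.

Lemma spectral_distribution : distribution H.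
Proof.
split=> [t|s t st|s i z zlb|a b ab t].
- exact: gammaZ_ge0.
- have [_ +] := spectral_left_cont hF s; rewrite -[_ <= _]/(F s <= F t).
  apply=> _ [r rs <-]; have [+ _] := spectral_left_cont hF t; apply.
  by exists r => // i; exact: lt_le_trans (rs i) (st i).
- apply: (gammaZ_infimum0 _ (spectral_inf hF s i)).
    by exists (F (subst_coord s i 0)), 0.
  by move=> _ [r _ <-]; exact: zlb.
- exact: (spectral_volume hF).
Qed.

Let H_mono := dist_mono spectral_distribution.

Lemma spectral_left_lub t z : (forall s, ltv s t -> H s <= z) -> H t <= z.
Proof.
move=> zub; apply: (gammaZ_supremum _ (spectral_left_cont hF t)).
  by have [s st] := ltv_exists t; exists (F s), s.
by move=> _ [s st <-]; exact: zub.
Qed.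

Lemma spectral_level_left_cont t : exists2 s, ltv s t & (H s).1 = (H t).1.
Proof.
have [x||_ [s st <-] e] := @lexZ_lub_level G [set H s | s in [set s | ltv s t]] (H t).
- by move=> [s st <-]; apply: H_mono => i; exact/ltW/st.
- by move=> z zub; apply: spectral_left_lub => s st; apply: zub; exists s.
- by exists s.
Qed.

Lemma spectral_level_low s i : exists r, (H (subst_coord s i r)).1 = 0.
Proof.
have [x||_ [r _ <-] e] := @lexZ_glb_level G (range (fun r => H (subst_coord s i r))) 0.
- by move=> [r _ <-]; exact: gammaZ_ge0.
- by move=> z zlb; apply: (dist_low spectral_distribution) => r; apply: zlb; exists r.
- by exists r.
Qed.

Lemma spectral_lub z : (forall s, H s <= z) -> one <= z.
Proof.
move=> zub; apply: (gammaZ_supremum _ (spectral_sup hF)).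
  by exists (F 0), 0.
by move=> _ [s _ <-]; exact: zub.
Qed.

Lemma spectral_stable : exists N, stable_from N (fun N => H (@diag_pt R n N)).
Proof.
have [x||_ [t _ <-] e] := @lexZ_lub_level G (range H) one.
- by move=> [s _ <-]; exact: gammaZ_le1.
- by move=> z zub; apply: spectral_lub => s; apply: zub; exists s.
- have [N tN] := lev_diag_pt t; exists N; split.
    by move=> i j ij; apply/H_mono/lev_diag_mono.
  exists one => m Nm; split; first exact: gammaZ_le1.
  apply/eqP; rewrite eq_le (lexZ_le1 (gammaZ_le1 _)) -e /=.
  apply: lexZ_le1; apply: H_mono => i; apply: (le_trans (tN i)).
  exact: lev_diag_mono.
Qed.

(* Condition (v) enters only here: below [t] and in its level, [F] stays above
   the element attached to the block of [t]. *)
Lemma spectral_level_bound t (j : nat) : (0 < j)%N -> (H t).1 = j%:Z ->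
  exists2 e : lexZ G, e.1 = j%:Z &
    forall s, lev s t -> (H s).1 = j%:Z -> e <= H s.
Proof.
move=> j0 tj; have jk : (0 < j <= k)%N.
  by rewrite j0 -lez_nat -tj; exact: (lexZ_le1 (gammaZ_le1 (F t))).
pose B := [set s | level_set F j s /\ level_rel F j s t].
have minE s : lev s t -> minv s t = s.
  by move=> st; apply/rowP => i; rewrite mxE; apply/min_idPl.
have BB : block F j B by exists t.
have Bt : B t by split=> //; rewrite /level_rel minE// => i.
pose c : 'rV[R]_n := \row_i inf [set s 0 i | s in B].
(* Far down in coordinate [i] the level is 0, whereas [minv s t] has level [j > 0]; so the infimum
   [c] is a genuine one. *)
have Blb i : has_lbound [set s 0 i | s in B].
  have [r hr] := spectral_level_low t i; exists r => _ [s [sj st] <-].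
  rewrite leNgt; apply/negP => sr.
  have : (H (minv s t)).1 <= (H (subst_coord t i r)).1.
    apply: lexZ_le1; apply: H_mono => l; rewrite !mxE.
    by case: eqP => [->|_]; rewrite ge_min ?lexx ?orbT// ltW.
  by rewrite hr; have := st; rewrite /level_rel /level_set /gamma_level /= /H => ->; lia.
have cB : char_point_of B c.
  move=> i; rewrite mxE; split=> [x Sx|x xlb]; first exact: inf_lbound.
  by apply: lb_le_inf => //; exists (t 0 i), t.
have [a [alb _] aj] := spectral_char hF jk BB cB.
exists (val a) => // s st sj.
(* Condition (v) concerns points strictly above [c] in every coordinate; left continuity puts a
   point [r] of the block strictly below [s], so [s] is one of them. *)
have [r rs rj] := spectral_level_left_cont s.
have rt : lev r t by move=> i; apply: le_trans (st i); exact/ltW.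
have Br : B r.
  have rj' : level_set F j r by rewrite /level_set /gamma_level /= -/(H r) rj.
  by split=> //; rewrite /level_rel minE.
apply: alb; exists s => // i; apply: le_lt_trans (rs i).
by rewrite mxE; apply: inf_lbound => //; exists r.
Qed.

End SpectralResolution.

(** * Lower bounds along a path of positive level *)

Section PathBounded.
Variables (R : realType) (n k : nat) (G : lgroupType).
Hypothesis hG : dedekind_sigma_complete G.
Variables (F : 'rV[R]_n -> gammaZ G k) (hF : spectral_resolution F).
Variables (qi : nat -> 'I_n) (qr : nat -> R).
Hypothesis q_dense : forall i (x y : R), x < y ->
  exists m, qi m = i /\ x < qr m < y.

Let H t : lexZ G := val (F t).
Let dH : distribution H := spectral_distribution hF.

Variable N0 : nat.
Hypothesis H_stable : stable_from N0 (fun N => H (diag_pt R n N)).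
Let p := cell_limit hG dH qi qr H_stable.

Section OnePath.
Variable beta : nat -> bool.
Let T : 'rV[R]_n := diag_pt R n N0.
Let lo m := clip_word qi qr (initial_word beta m) (@ninf R n).
Let up m := clip_word qi qr (initial_word beta m) (corner T).
Let mass m := box_mass H (lo m) (up m).
Hypothesis mass_gt0 : forall m, 0 < (mass m).1.

Let up_fin m : finite_point (up m).
Proof. by apply: clip_word_finite => i. Qed.

Let lo_le_up m i : (lo m i <= up m i)%E.
Proof. by apply: clip_word_mono => j; rewrite leNye. Qed.

Let lo_lt_up m i : (lo m i < up m i)%E.
Proof.
rewrite lt_neqAle lo_le_up andbT; apply/negP => /eqP e.
by have := mass_gt0 m; rewrite /mass (box_mass_flat _ e).
Qed.

Let loS m : lo m.+1 = upd (lo m) (qi m) (clip (beta m) (qr m)%:E (lo m (qi m))).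
Proof. by rewrite /lo /= size_initial_word. Qed.

Let upS m : up m.+1 = upd (up m) (qi m) (clip (beta m) (qr m)%:E (up m (qi m))).
Proof. by rewrite /up /= size_initial_word. Qed.

Let nestedS m i : (lo m i <= lo m.+1 i)%E /\ (up m.+1 i <= up m i)%E.
Proof.
have := lo_lt_up m.+1 i; rewrite loS upS /upd; case: eqP => [->|_ _]; last by [].
have := lo_lt_up m (qi m); rewrite /clip; case: (beta m) => lu.
  have [h|h] := leP (lo m (qi m)) (qr m)%:E; first by split; rewrite // ge_min lexx.
  by rewrite (min_idPr (ltW (lt_trans h lu))) ltxx.
have [h|h] := leP (qr m)%:E (up m (qi m)); first by split; rewrite // le_max lexx.
by rewrite (max_idPr (ltW (lt_trans lu h))) ltxx.
Qed.

Let lo_mono m m' i : (m <= m')%N -> (lo m i <= lo m' i)%E.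
Proof.
by move=> /subnK <-; elim: (m' - m)%N => // d /le_trans; apply; exact: (nestedS _ i).1.
Qed.

Let up_mono m m' i : (m <= m')%N -> (up m' i <= up m i)%E.
Proof.
by move=> /subnK <-; elim: (m' - m)%N => // d; apply: le_trans; exact: (nestedS _ i).2.
Qed.

Let up_le m i : (up m i <= corner T i)%E.
Proof. exact: (up_mono i (leq0n m)). Qed.

Let lo_lt_up' m m' i : (lo m i < up m' i)%E.
Proof.
apply: (le_lt_trans (lo_mono i (leq_maxl m m'))).
exact: lt_le_trans (lo_lt_up _ i) (up_mono i (leq_maxr m m')).
Qed.

Let u m i := fine (up m i).

Let uE m i : up m i = (u m i)%:E.
Proof. by rewrite /u fineK//; exact: up_fin. Qed.

(** Below [T], all mass with [i]-th coordinate under a suitable [r] has level 0, while the masses of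
    the boxes keep a positive level. *)
Let u_lb i : exists r, forall m, r <= u m i.
Proof.
have [r hr] := spectral_level_low hF T i; exists r => m; rewrite leNgt; apply/negP => ur.
have := mass_gt0 m; suff: (mass m).1 <= 0 by rewrite leNgt => /negbTE ->.
have h1 : mass m <= box_mass H (@ninf R n) (up m).
  by apply: (box_mass_sub dH (up_fin _) (up_fin _)) => // j; rewrite leNye.
apply: (le_trans (lexZ_le1 h1)); rewrite box_mass_ninf (ext_dist_finite _ (up_fin m)) -hr.
apply: lexZ_le1; apply: (dist_mono dH) => j; rewrite !mxE.
case: eqP => [->|_]; first exact: (ltW ur).
by have := up_le m j; rewrite uE /corner lee_fin mxE.
Qed.

Let c i := inf [set u m i | m in setT].

Let c_le m i : c i <= u m i.
Proof.
apply: inf_lbound; last by exists m.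
by have [r hr] := u_lb i; exists r => _ [m' _ <-].
Qed.

Let le_c i x : (forall m, x <= u m i) -> x <= c i.
Proof. by move=> h; apply: lb_le_inf => [|_ [m _ <-]//]; exists (u 0%N i), 0%N. Qed.

Let lo_le_c m i : (lo m i <= (c i)%:E)%E.
Proof.
have := fun m' => lo_lt_up' m m' i; case: (lo m i) => [x h|h|]; last by rewrite leNye.
  by rewrite lee_fin; apply: le_c => m'; have := h m'; rewrite uE lte_fin => /ltW.
by have := h 0%N; rewrite uE.
Qed.

(** Some threshold between [x] and [c i] is asked; a positive answer would bring the upper end below
    [c i], so the lower end has moved past the threshold. *)
Let lo_cvg i x : x < c i -> exists M, forall m, (M <= m)%N -> (x%:E <= lo m i)%E.
Proof.
move=> xc; have [m0 [im0 /andP[xq qc]]] := q_dense i xc.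
exists m0.+1 => m /(lo_mono i); apply: le_trans.
have := c_le m0.+1 i; rewrite -lee_fin -uE upS loS -im0 !updE.
case: (beta m0); rewrite /clip.
  by rewrite le_min im0 => /andP[_]; rewrite lee_fin leNgt qc.
by move=> _; rewrite le_max [X in _ || X]lee_fin (ltW xq) orbT.
Qed.

(* Left continuity of the level: the slices just to the left of [c i] have
   level 0. *)
Let slice_level i : exists M, forall m, (M <= m)%N ->
  forall a b, finite_point b -> (forall j, (a j <= b j)%E) ->
    (forall j, (b j <= corner T j)%E) -> a i = lo m i -> b i = (c i)%:E ->
    (box_mass H a b).1 = 0.
Proof.
have [r rt rE] := spectral_level_left_cont hF (subst_coord T i (c i)).
have [|M MP] := @lo_cvg i (r 0 i); first by have := rt i; rewrite mxE eqxx.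
exists M => m Mm a b fb ab bT ai bi.
have b0 := lexZ_le1 (box_mass_ge0 dH fb ab).
apply/eqP; rewrite eq_le b0 andbT.
have fT : finite_point (corner T) by [].
have := lexZ_le1 (box_mass_slice dH i fb fT ab bT) => /le_trans; apply.
rewrite ai bi /= subr_le0.
have rlo := MP _ Mm.
have flo : (lo m i) = (fine (lo m i))%:E.
  rewrite fineK// fin_numE; apply/andP; split.
    by rewrite -ltNye; apply: lt_le_trans rlo; rewrite ltNye.
  by rewrite -ltey; apply: le_lt_trans (lo_le_c m i) _; rewrite ltey.
rewrite !ext_dist_finite; last 2 first.
- by move=> j; rewrite /upd; case: eqP; rewrite // flo.
- by move=> j; rewrite /upd; case: eqP.
apply: (@le_trans _ _ (H r).1).
  rewrite rE; apply: lexZ_le1; apply: (dist_mono dH) => j; rewrite !mxE /upd.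
  by case: eqP => _; rewrite /= ?mxE.
apply: lexZ_le1; apply: (dist_mono dH) => j; rewrite !mxE /upd.
case: eqP => [->|/eqP ji]; first by rewrite -lee_fin -flo.
by have := rt j; rewrite /= !mxE (negbTE ji) => /ltW.
Qed.

Let cE i : \bar R := (c i)%:E.

(** Bounds on both sides in one level are needed because a mass is an alternating sum, and a
    difference exchanges upper and lower bounds. *)
Let tame (h : nat -> lexZ G) := exists (e1 e2 : lexZ G) M,
  e1.1 = e2.1 /\ forall m, (M <= m)%N -> e1 <= h m /\ h m <= e2.

(** The corner decreases with [m], so its level stabilizes. If that level is positive,
    [spectral_level_bound] bounds [F] from below inside it; in level 0 the bound is 0. *)
Let tame_corner (s : 'I_n -> bool) :
  tame (fun m => ext_dist H (fun i => if s i then cE i else up m i)).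
Proof.
pose v m : 'rV[R]_n := \row_i (if s i then c i else u m i).
have vE m : ext_dist H (fun i => if s i then cE i else up m i) = H (v m).
  rewrite ext_dist_finite; last by move=> i; case: (s i) => //; exact: up_fin.
  by congr H; apply/rowP => i; rewrite !mxE; case: (s i).
have v_mono m m' : (m <= m')%N -> lev (v m') (v m).
  move=> mm i; rewrite !mxE; case: (s i) => //.
  by rewrite -lee_fin -!uE; exact: up_mono.
have [m m' mm|m|M MP] := @int_nonincreasing_stable (fun m => (H (v m)).1).
- by apply: lexZ_le1; apply: (dist_mono dH); exact: v_mono.
- exact: lexZ_le1 (dist_ge0 dH _).
have [j0|j0] := leP (H (v M)).1 0.
  exists 0, (H (v M)), M; split=> [|m Mm].
    by apply/eqP; rewrite eq_le j0 andbT; exact: lexZ_le1 (dist_ge0 dH _).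
  rewrite vE; split; first exact: dist_ge0.
  by apply: (dist_mono dH); exact: v_mono.
have [j jE] : exists j : nat, (H (v M)).1 = j%:Z by exists `|(H (v M)).1|%N; lia.
have j1 : (0 < j)%N by rewrite -ltz_nat -jE.
have [e e1 eP] := spectral_level_bound hF j1 jE.
exists e, (H (v M)), M; split=> [|m Mm]; first by rewrite e1 jE.
rewrite vE; split; last by apply: (dist_mono dH); exact: v_mono.
by apply: eP; [exact: v_mono|rewrite -jE; exact: MP].
Qed.

Let tame_box : tame (fun m => box_mass H cE (up m)).
Proof.
have tl l s : tame (fun m => partial_mass H l cE (up m)
    (fun i => if s i then cE i else up m i)).
  elim: l s => [|i l IH] s /=; first exact: tame_corner.
  have [e1 [e2 [M [e12 eP]]]] := IH (fun j => (j != i) && s j).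
  have [d1 [d2 [L [d12 dP]]]] := IH (fun j => (j == i) || s j).
  exists (e1 - d2), (e2 - d1), (maxn M L); split; first by rewrite /= e12 d12.
  move=> m; rewrite geq_max => /andP[/eP[m1 m2] /dP[m3 m4]].
  have -> : upd (fun j => if s j then cE j else up m j) i (up m i) =
      fun j => if (j != i) && s j then cE j else up m j.
    by apply/funext => j; rewrite /upd; case: eqP => [->|].
  have -> : upd (fun j => if s j then cE j else up m j) i (cE i) =
      fun j => if (j == i) || s j then cE j else up m j.
    by apply/funext => j; rewrite /upd; case: eqP => [->|].
  by split; exact: lg_leB.
have [e1 [e2 [M [e12 eP]]]] := tl (enum 'I_n) (fun=> true).
exists e1, e2, M; split=> // m /eP; rewrite /box_mass.
rewrite (@partial_mass_ext _ _ _ _ _ _ _ _ cE (up m) (@ninf R n))// => i.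
by rewrite mem_enum.
Qed.

(** Moving the lower end from [lo m'] to [c] removes one slice per coordinate, each of level 0 for
    large [m']. Corners mixing [lo m] and [up m] need not decrease, so [tame_corner] could not
    handle them. *)
Let level_box M : (forall m, (M <= m)%N -> (mass m).1 = (mass M).1) ->
  forall m, (M <= m)%N -> (box_mass H cE (up m)).1 = (mass M).1.
Proof.
move=> MP m Mm.
have /choice[L LP] := slice_level.
pose m' := maxn m (\max_i L i)%N.
have lm' i : (L i <= m')%N by rewrite leq_max (leq_bigmax i) orbT.
have mm' : (m <= m')%N by exact: leq_maxl.
have <- : (box_mass H (lo m') (up m)).1 = (mass M).1.
  apply/eqP; rewrite eq_le -{1}(MP m Mm) -(MP m' (leq_trans Mm mm')).
  apply/andP; split; apply: lexZ_le1; apply: (box_mass_sub dH (up_fin _) (up_fin _)) => // i.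
  - exact: lo_mono.
  - exact/ltW/lo_lt_up'.
  - exact: up_mono.
pose x (l : seq 'I_n) i := if i \in l then cE i else lo m' i.
have xup l i : (x l i <= up m i)%E.
  rewrite /x; case: ifP => _; last exact/ltW/lo_lt_up'.
  by rewrite uE lee_fin.
have xl l : (box_mass H (x l) (up m)).1 = (box_mass H (lo m') (up m)).1.
  elim: l => [|i l <-]; first by congr (box_mass _ _ _).1.
  have xi : x (i :: l) = upd (x l) i (cE i).
    by apply/funext => j; rewrite /x /upd in_cons; case: eqP => // ->.
  have [il|il] := boolP (i \in l).
    congr (box_mass _ _ _).1; apply/funext => j; rewrite /x in_cons.
    by case: eqP => // ->; rewrite il.
  rewrite (box_mass_cut _ (x l) _ i (cE i)) -xi /= [X in _ = X + _](LP i _ (lm' i)) ?add0r//.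
  - by move=> j; rewrite /upd; case: eqP => // _; exact: up_fin.
  - move=> j; rewrite /upd; case: eqP => [->|_]; last exact: xup.
    by rewrite /x (negbTE il); exact: lo_le_c.
  - move=> j; rewrite /upd; case: eqP => [->|_]; last exact: up_le.
    by apply: le_trans (up_le m i); rewrite uE lee_fin.
  - by rewrite /x (negbTE il).
  - by rewrite updE.
rewrite -(xl (enum 'I_n)); congr (box_mass _ _ _).1.
by apply/funext => i; rewrite /x mem_enum.
Qed.

Lemma one_path_bounded : exists (e : lexZ G) M, forall m, (M <= m)%N ->
  e <= mass m /\ e.1 = (mass m).1.
Proof.
have mass_le m m' : (m <= m')%N -> mass m' <= mass m.
  move=> mm; apply: (box_mass_sub dH (up_fin _) (up_fin _)) => // i;
    [exact: lo_mono|exact: up_mono].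
have [m m' mm|m|M MP] := @int_nonincreasing_stable (fun m => (mass m).1).
- exact/lexZ_le1/mass_le.
- exact/ltW/mass_gt0.
have [e1 [e2 [L [e12 eP]]]] := tame_box.
exists e1, (maxn M L) => m; rewrite geq_max => /andP[Mm Lm].
have [m1 m2] := eP _ Lm; have lm := level_box MP Mm.
split.
  apply: (le_trans m1); apply: (box_mass_sub dH (up_fin _) (up_fin _)) => // i.
  by rewrite uE lee_fin.
apply/eqP; rewrite eq_le (MP m Mm) -lm (lexZ_le1 m1) e12.
exact: (lexZ_le1 m2).
Qed.

End OnePath.

(** The weights [p] have the same levels as the masses truncated at [diag_pt N0] and dominate them,
    so a lower bound for the latter suffices; a path that reaches level 0 is bounded by 0. *)
Lemma cell_limit_path_bounded : path_bounded p.
Proof.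
move=> beta.
have p_mono m m' : (m <= m')%N -> p (initial_word beta m') <= p (initial_word beta m).
  move=> /subnK <-; elim: (m' - m)%N => // d; apply: le_trans.
  rewrite addSn /= /p [X in _ <= X]cell_limitD.
  by case: (beta _); rewrite ?lg_leDl ?lg_leDr ?cell_limit_ge0.
have pm m := cell_limit_level hG dH qi qr H_stable (initial_word beta m) (leqnn N0).
have [h|h] := pselect (forall m, 0 < (p (initial_word beta m)).1).
  have [m|e [M eM]] := @one_path_bounded beta; first by rewrite pm.
  exists e, M => m /eM[e1 e2]; split; last by rewrite e2 pm.
  exact: le_trans e1 (cell_mass_le_limit hG dH qi qr H_stable _ _).
have [M hM] : exists M, ~ 0 < (p (initial_word beta M)).1.
  by apply: contrapT => hn; apply: h => m; apply: contrapT => hm; apply: hn; exists m.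
exists 0, M => m Mm; split; first exact: cell_limit_ge0.
have := lexZ_le1 (p_mono _ _ Mm);
  have := lexZ_le1 (cell_limit_ge0 hG dH qi qr H_stable (initial_word beta m)).
by move: hM; rewrite /p /=; lia.
Qed.

End PathBounded.

(** * Observables on Euclidean space *)

Section OrthantBorel.
Variables (R : realType) (n : nat).
Implicit Types (s t : 'rV[R]_n) (A : set 'rV[R]_n).

Definition orthants : set_system 'rV[R]_n := range (@lower_orthant R n).

Lemma orthants_setI : setI_closed orthants.
Proof.
move=> _ _ [s _ <-] [t _ <-]; exists (minv s t) => //.
apply/seteqP; split=> [r rst|r [rs rt] i].
  by split=> i; have := rst i; rewrite mxE lt_min => /andP[].
by rewrite mxE lt_min rs rt.
Qed.

Lemma orthant_open t : open (lower_orthant t).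
Proof.
rewrite openE => s st; rewrite /interior /lower_orthant /=.
apply: (filter_forall (F := nbhs s)) => i.
apply: (@coord_continuous R 1 n 0 i s [set x | x < t 0 i]).
by apply: open_nbhs_nbhs; split; [exact: open_lt|exact: st].
Qed.

(** Half-spaces are countable unions of orthants, half-open rational boxes are obtained from
    half-spaces, and every open set is a countable union of such boxes. *)
Lemma borel_orthants : @borel_rV R n = <<s orthants >>.
Proof.
apply/seteqP; split; apply: smallest_sub; try exact: smallest_sigma_algebra; last first.
  by move=> _ [t _ <-]; apply: sub_sigma_algebra; exact: orthant_open.
move=> U oU; pose M := g_sigma_algebraType orthants.
have half i (r : R) : @measurable _ M [set s | s 0 i < r].
  rewrite [X in _ X](_ : _ = \bigcup_N lower_orthant (subst_coord (diag_pt R n N) i r)).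
    apply: (@bigcupT_measurable _ M) => N.
    by apply: sub_sigma_algebra; exists (subst_coord (diag_pt R n N) i r).
  apply/seteqP; split=> [s /= sr|s [N _ /(_ i)]]; last by rewrite mxE eqxx.
  have [N sN] := lev_diag_pt s; exists N.+1 => // j; rewrite mxE.
  by case: eqP => [->//|_]; apply: le_lt_trans (sN j) _; rewrite !mxE ltr_nat.
pose box (ab : {ffun 'I_n -> rat} * {ffun 'I_n -> rat}) : set 'rV[R]_n :=
  [set s | forall i, ratr (ab.1 i) <= s 0 i < ratr (ab.2 i)].
have mbox ab : @measurable _ M (box ab).
  have -> : box ab = \bigcap_(i in [set: 'I_n])
      ([set s | s 0 i < ratr (ab.2 i)] `\` [set s | s 0 i < ratr (ab.1 i)]).
    apply/seteqP; split=> [s sab i _|s h i].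
      by have /andP[h1 h2] := sab i; split=> //=; apply/negP; rewrite -leNgt.
    by have [//= h2 /negP] := h i I; rewrite -leNgt h2 => ->.
  by apply: (@fin_bigcap_measurable _ M) => // i _; exact: (@measurableD _ M).
rewrite (_ : U = \bigcup_ab (if `[< box ab `<=` U >] then box ab else set0)).
  apply: (@countable_bigcupT_measurable _ M) => // ab.
  by case: ifP => _ //; exact: (@measurable0 _ M).
apply/seteqP; split=> [s Us|s [ab _]]; last by case: asboolP => // h; exact: h.
have /nbhs_ballP[e /= e0 sU] : nbhs s U by exact: open_nbhs_nbhs.
have /choice[a aP] : forall i, exists q : rat, s 0 i - e < ratr q < s 0 i.
  move=> i; have [|q] := @rat_in_itvoo R (s 0 i - e) (s 0 i); first by rewrite ltrBlDr ltrDl.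
  by rewrite in_itv; exists q.
have /choice[b bP] : forall i, exists q : rat, s 0 i < ratr q < s 0 i + e.
  move=> i; have [|q] := @rat_in_itvoo R (s 0 i) (s 0 i + e); first by rewrite ltrDl.
  by rewrite in_itv; exists q.
exists ([ffun i => a i], [ffun i => b i]) => //; rewrite asboolT.
  move=> i; rewrite !ffunE.
  by have /andP[_ /ltW ->] := aP i; have /andP[-> _] := bP i.
move=> r rab; apply: sU; split=> // i j; rewrite (ord1 i).
rewrite /ball /= ltr_norml.
have := rab j; rewrite !ffunE /=; have := aP j; have := bP j.
by move=> /andP[b1 b2] /andP[a1 a2] /andP[r1 r2]; apply/andP; split; lra.
Qed.

End OrthantBorel.

(** * Measurability on the path space *)

Section PathAlgebra.

Lemma path_algebra_bit m b : path_algebra [set beta | beta m = b].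
Proof.
rewrite (_ : [set beta | _] = \bigcup_(w : seq bool)
    (if size w == m then cylinder (b :: w) else set0)).
  apply: (@countable_bigcupT_measurable _ (g_sigma_algebraType cylinders)) => // w.
  case: ifP => _; first exact: path_algebra_cylinder.
  exact: (@measurable0 _ (g_sigma_algebraType cylinders)).
apply/seteqP; split=> [beta bm|beta [w _]]; last by case: eqP => // <- [].
exists (initial_word beta m) => //; rewrite size_initial_word eqxx; split=> /=.
  exact: cylinder_initial_word.
by rewrite size_initial_word.
Qed.

Lemma path_algebra_forall (I : finType) (P : I -> set (nat -> bool)) :
  (forall i, path_algebra (P i)) -> path_algebra [set beta | forall i, P i beta].
Proof.
move=> mP; rewrite (_ : [set beta | _] = \bigcap_(i in [set: I]) P i).
  by apply: (@fin_bigcap_measurable _ (g_sigma_algebraType cylinders)) => // i _; exact: mP.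
by apply/seteqP; split=> [beta h i _|beta h i]; apply: h.
Qed.

Lemma path_algebra_exists (P : nat -> set (nat -> bool)) :
  (forall m, path_algebra (P m)) -> path_algebra [set beta | exists m, P m beta].
Proof.
move=> mP; rewrite (_ : [set beta | _] = \bigcup_m P m); first exact: path_algebra_bigcup.
by apply/seteqP; split=> [beta [m h]|beta [m _ h]]; exists m.
Qed.

Lemma path_algebra_andl (b : Prop) (P : set (nat -> bool)) :
  path_algebra P -> path_algebra [set beta | b /\ P beta].
Proof.
move=> mP; have [hb|hb] := pselect b.
  by rewrite (_ : [set beta | _] = P)//; apply/seteqP; split=> // beta [].
rewrite (_ : [set beta | _] = set0); last by apply/seteqP; split=> // beta [].
exact: (@measurable0 _ (g_sigma_algebraType cylinders)).
Qed.

Lemma cylinder_nonempty w : cylinder w !=set0.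
Proof.
suff H beta : (forall m, (m < size w)%N -> beta m = nth false (rev w) m) ->
    cylinder w beta by exists (nth false (rev w)); exact: H.
elim: w => // b w IH h; split; last first.
  by rewrite /= h//= rev_cons nth_rcons size_rev ltnn eqxx.
apply: IH => m mw; rewrite h /=; last exact: ltnW.
by rewrite rev_cons nth_rcons size_rev mw.
Qed.

Lemma cylinder_agree w beta gamma : cylinder w beta -> cylinder w gamma ->
  forall m, (m < size w)%N -> beta m = gamma m.
Proof.
elim: w => // b w IH [wb bb] [wg gg] m; rewrite ltnS leq_eqVlt => /orP[/eqP ->|].
  by rewrite bb gg.
exact: IH.
Qed.

End PathAlgebra.

(** * From the measure on paths to an observable *)

Section Extension.
Variables (R : realType) (n k : nat) (G : lgroupType).
Hypothesis hG : dedekind_sigma_complete G.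
Variables (F : 'rV[R]_n -> gammaZ G k) (hF : spectral_resolution F).
Variables (qi : nat -> 'I_n) (qr : nat -> R).
Hypothesis q_dense : forall i (x y : R), x < y ->
  exists m, qi m = i /\ x < qr m < y.

Let H t : lexZ G := val (F t).
Let dH : distribution H := spectral_distribution hF.

Variable N0 : nat.
Hypothesis H_stable : stable_from N0 (fun N => H (diag_pt R n N)).
Let p := cell_limit hG dH qi qr H_stable.

Variable X : set (nat -> bool) -> lexZ G.
Hypothesis (mX : vector_measure path_algebra X) (XE : forall w, X (cylinder w) = p w).

Let X_le A B : path_algebra A -> path_algebra B -> A `<=` B -> X A <= X B.
Proof. by move=> mA mB; apply: vector_measure_le mX _ _ _ => //; exact: path_algebraD. Qed.

Let X0 : X set0 = 0.
Proof.
have m0 := @measurable0 _ (g_sigma_algebraType cylinders).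
by have := vector_measureB mX m0 m0; rewrite setDv subrr; apply.
Qed.

Let XU A B : path_algebra A -> path_algebra B -> X (A `|` B) <= X A + X B.
Proof.
move=> mA mB; have mBA := path_algebraD mB mA.
rewrite (_ : A `|` B = A `|` (B `\` A)); last first.
  apply/seteqP; split=> x [xA|]; [by left| |by left|by move=> [xB _]; right].
  by have [xA|xA] := pselect (A x); [left|right].
rewrite (vmD mX)//; last exact: setDIK.
by rewrite lg_leD2l; apply: X_le => // x [].
Qed.

Let X_split A w : path_algebra A ->
  X (A `&` cylinder w) = X (A `&` cylinder (true :: w)) + X (A `&` cylinder (false :: w)).
Proof.
move=> mA; rewrite -(vmD mX); try by apply: path_algebraI => //; exact: path_algebra_cylinder.
  by rewrite -setIUr -cylinder_split.
by rewrite setIACA setIid cylinder_disjoint setI0.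
Qed.

Let hit (t : 'rV[R]_n) i (m : nat) : set (nat -> bool) :=
  [set beta | (qi m = i /\ qr m < t 0 i) /\ beta m].

Let mhit t i m : path_algebra (hit t i m).
Proof. by apply: path_algebra_andl; exact: path_algebra_bit. Qed.

(** Being strictly below [t] is certified in each coordinate by a positive answer at a threshold
    smaller than [t 0 i]. *)
Let below t : set (nat -> bool) := [set beta | forall i, exists m, hit t i m beta].

Let below_upto t M : set (nat -> bool) :=
  [set beta | forall i, exists m, (m < M)%N /\ hit t i m beta].

Let mbelow t : path_algebra (below t).
Proof.
by apply: (@path_algebra_forall _ (fun i => [set beta | exists m, hit t i m beta])) => i;
  exact: path_algebra_exists.
Qed.

Let mbelow_upto t M : path_algebra (below_upto t M).
Proof.
apply: (@path_algebra_forall _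
  (fun i => [set beta | exists m, (m < M)%N /\ hit t i m beta])) => i.
apply: (@path_algebra_exists (fun m => [set beta | (m < M)%N /\ hit t i m beta])) => m.
exact: path_algebra_andl.
Qed.

Let up T beta M := clip_word qi qr (initial_word beta M) (@corner R n T).
Let lo beta M := clip_word qi qr (initial_word beta M) (@ninf R n).

Let upS T beta M : up T beta M.+1 =
  upd (up T beta M) (qi M) (clip (beta M) (qr M)%:E (up T beta M (qi M))).
Proof. by rewrite /up /= size_initial_word. Qed.

Let loS beta M : lo beta M.+1 =
  upd (lo beta M) (qi M) (clip (beta M) (qr M)%:E (lo beta M (qi M))).
Proof. by rewrite /lo /= size_initial_word. Qed.

(* Once the answers place the coordinate [i] below some [q < t i], enlarging [t]
   no longer changes the upper end of the cell. *)
Let up_hit t T beta i M : lev t T ->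
  ((exists m, (m < M)%N /\ hit t i m beta) -> up T beta M i = up t beta M i) /\
  (~ (exists m, (m < M)%N /\ hit t i m beta) -> ((t 0 i)%:E <= up t beta M i)%E).
Proof.
move=> tT; elim: M => [|M [IH1 IH2]]; first by split=> [[m []]//|_].
have hitM m : (m < M)%N -> hit t i m beta ->
    exists m, (m < M.+1)%N /\ hit t i m beta.
  by move=> mM h; exists m; split=> //; exact: ltnW.
have [iM|iM] := eqVneq i (qi M); last first.
  rewrite !upS /upd (negbTE iM); split=> [[m [+ h]]|h].
    rewrite ltnS leq_eqVlt => /orP[/eqP mM|mM]; last by apply: IH1; exists m.
    by move: h => [[qm _] _]; rewrite -mM qm eqxx in iM.
  by apply: IH2 => -[m [mM hm]]; apply: h; exact: hitM mM hm.
rewrite !upS -iM !updE.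
have [hM|hM] := pselect (exists m, (m < M)%N /\ hit t i m beta).
  rewrite IH1//; split=> // h; exfalso; apply: h.
  by move: hM => [m [mM hm]]; exact: hitM mM hm.
have tup := IH2 hM.
have upT : (up t beta M i <= up T beta M i)%E.
  by apply: clip_word_mono => j; rewrite lee_fin.
split=> [[m [+ hm]]|h].
  rewrite ltnS leq_eqVlt => /orP[/eqP mM|mM]; last by exfalso; apply: hM; exists m.
  rewrite mM in hm; move: hm => [[_ qt] ->]; rewrite /clip.
  have qu : ((qr M)%:E <= up t beta M i)%E.
    by apply: le_trans tup; rewrite lee_fin ltW.
  by rewrite (min_idPr qu) (min_idPr (le_trans qu upT)).
rewrite /clip; case bM : (beta M); last by rewrite le_max tup.
rewrite le_min tup lee_fin leNgt; apply/negP => qt.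
by apply: h; exists M; split=> //; split=> //; rewrite iM.
Qed.

(** Words of length [M] are examined one by one: in a cell meeting [below_upto t M] every upper end
    is already fixed by the answers, so truncating at a larger [T] gives the same mass as truncating
    at [t]. *)
Let X_below_le t : X (below t) <= H t.
Proof.
have XM M : X (below_upto t M) <= H t.
  have h w : (size w <= M)%N -> X (below_upto t M `&` cylinder w) <= cell_mass H qi qr t w.
    have [d] := ubnP (M - size w); elim: d w => // d IH w wd wM.
    have [wlt|Mw] := ltnP (size w) M.
      rewrite X_split// cell_massD; apply: lg_leD; apply: IH => //=; lia.
    have {}wM : size w = M by apply/eqP; rewrite eqn_leq wM.
    have [[beta [bM wb]]|ne] := pselect ((below_upto t M `&` cylinder w) !=set0); last first.
      rewrite (_ : _ `&` _ = set0) ?X0; first exact: cell_mass_ge0.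
      by apply/eqP/negPn/negP => /set0P.
    apply: (@le_trans _ _ (X (cylinder w))).
      apply: X_le => [||? []//]; last exact: path_algebra_cylinder.
      by apply: path_algebraI => //; exact: path_algebra_cylinder.
    rewrite XE; have [_] := cell_limit_sup hG dH qi qr H_stable w; apply.
    move=> _ [N _ <-].
    pose T : 'rV[R]_n := \row_i Num.max (t 0 i) N%:R.
    have tT : lev t T by move=> i; rewrite mxE le_max lexx.
    apply: (@le_trans _ _ (cell_mass H qi qr T w)).
      by apply: (cell_mass_mono dH) => i; rewrite !mxE le_max lexx orbT.
    move/cylinderP: wb; rewrite wM => <-; rewrite /cell_mass.
    suff -> : clip_word qi qr (initial_word beta M) (corner T) =
              clip_word qi qr (initial_word beta M) (corner t) by [].
    by apply/funext => i; exact: (up_hit beta i M tT).1 (bM i).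
  by have := h [::] (leq0n _); rewrite setIT cell_mass_nil.
have -> : below t = \bigcup_M below_upto t M.
  apply/seteqP; split=> [beta bt|beta [M _ bM] i]; last first.
    by have [m [_ h]] := bM i; exists m.
  have /choice[m mP] := bt; exists (\max_i m i).+1 => // i; exists (m i).
  by rewrite ltnS (leq_bigmax i).
have [_] := vm_sup mX (mbelow_upto t)
  (fun M M' MM' beta h i => let: ex_intro m (conj mM hm) := h i in
    ex_intro _ m (conj (leq_trans mM MM') hm)).
by apply=> _ [M _ <-].
Qed.

(** A negative answer at the threshold [t 0 i] empties the part of the cell below [t]. The invariant
    [h] says that the upper end stays at most [t 0 i] until both ends have merged. *)
Let up_question (t : 'rV[R]_n) beta i m : t 0 i = qr m -> qi m = i -> ~~ beta m ->
  forall M, (m < M)%N -> lo beta M i = up t beta M i.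
Proof.
move=> tq im bm.
have h M : lo beta M i = up t beta M i \/ (up t beta M i <= (t 0 i)%:E)%E.
  elim: M => [|M IH]; first by right.
  have [iM|iM] := eqVneq i (qi M); last by rewrite loS upS /upd (negbTE iM).
  rewrite loS upS -iM !updE /clip; case: IH => [->|upt]; first by left.
  case: (beta M); first by right; rewrite ge_min upt.
  have [qt|tq'] := leP (qr M)%:E (t 0 i)%:E; first by right; rewrite ge_max upt.
  have uq := le_trans upt (ltW tq').
  have lu : (lo beta M i <= up t beta M i)%E by apply: clip_word_mono => j; rewrite leNye.
  by left; rewrite (max_idPr uq) (max_idPr (le_trans lu uq)).
elim=> // M IH; rewrite ltnS leq_eqVlt => /orP[/eqP <-|/IH e].
  rewrite loS upS -im !updE /clip (negbTE bm) im.
  have [->//|upt] := h m; rewrite tq in upt.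
  have lu : (lo beta m i <= up t beta m i)%E by apply: clip_word_mono => j; rewrite leNye.
  by rewrite (max_idPr upt) (max_idPr (le_trans lu upt)).
by rewrite loS upS /upd; case: eqP => // iM; rewrite -iM e.
Qed.

(** With thresholds [q] between [s] and [t], a cell with a negative answer at one of them has no
    mass below [q]; the other cells lie in [E], hence in [below t]. *)
Let le_X_below s t : ltv s t -> H s <= X (below t).
Proof.
move=> st.
have /choice[m mP] : forall i, exists m, qi m = i /\ s 0 i < qr m < t 0 i.
  by move=> i; exact: q_dense.
pose q : 'rV[R]_n := \row_i qr (m i).
pose E : set (nat -> bool) := [set beta | forall i, beta (m i)].
have mE : path_algebra E by apply: path_algebra_forall => i; exact: path_algebra_bit.
apply: (@le_trans _ _ (H q)).
  by apply: (dist_mono dH) => i; rewrite mxE; have [_ /andP[/ltW]] := mP i.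
apply: (@le_trans _ _ (X E)); last first.
  apply: X_le => // beta Eb i; exists (m i); split=> //.
  by have [mi /andP[_ mt]] := mP i.
pose M := (\max_i m i).+1.
have mM i : (m i < M)%N by rewrite ltnS (leq_bigmax i).
have h w : (size w <= M)%N -> cell_mass H qi qr q w <= X (E `&` cylinder w).
  have [d] := ubnP (M - size w); elim: d w => // d IH w wd wM.
  have [wlt|Mw] := ltnP (size w) M.
    rewrite X_split// cell_massD; apply: lg_leD; apply: IH => //=; lia.
  have {}wM : size w = M by apply/eqP; rewrite eqn_leq wM.
  have [beta wb] := cylinder_nonempty w.
  have [Eb|nEb] := pselect (E beta).
    rewrite (_ : E `&` _ = cylinder w) ?XE; first exact: cell_mass_le_limit.
    rewrite setIidr// => gamma wg i.
    by rewrite -(cylinder_agree wb wg) ?wM//; exact: Eb.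
  have [i bi] : exists i, ~~ beta (m i).
    by apply: contrapT => hn; apply: nEb => i;
       apply: contrapT => /negP hi; apply: hn; exists i.
  rewrite /cell_mass (box_mass_flat _ (i := i)); last first.
    move/cylinderP: wb; rewrite wM => <-.
    have qE : q 0 i = qr (m i) by rewrite mxE.
    exact: (@up_question q beta i (m i) qE (mP i).1 bi M (mM i)).
  by apply: (vm_ge0 mX); apply: path_algebraI => //; exact: path_algebra_cylinder.
by have := h [::] (leq0n _); rewrite setIT cell_mass_nil.
Qed.

Let X_below t : X (below t) = H t.
Proof.
apply/eqP; rewrite eq_le X_below_le /=.
by apply: (spectral_left_lub hF) => s; exact: le_X_below.
Qed.

Let unbounded i : set (nat -> bool) :=
  [set beta | forall N : nat, exists m, (qi m = i /\ qr m < - N%:R) /\ beta m].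

Let munbounded i : path_algebra (unbounded i).
Proof.
rewrite (_ : unbounded i = \bigcap_(N in [set: nat])
    [set beta | exists m, (qi m = i /\ qr m < - N%:R) /\ beta m]).
  apply: path_algebra_bigcap => N.
  apply: (@path_algebra_exists
    (fun m => [set beta | (qi m = i /\ qr m < - N%:R) /\ beta m])) => m.
  by apply: path_algebra_andl; exact: path_algebra_bit.
by apply/seteqP; split=> [beta h N _|beta h N]; [exact: h|exact: h N I].
Qed.

(** On [unbounded i] positive answers occur below every real, so the set lies in
    [below (subst_coord t i r)] for all [r], and [dist_low] applies. *)
Let X_unbounded t i : X (below t `&` unbounded i) <= 0.
Proof.
apply: (dist_low dH (s := t) (i := i)) => r.
have mI := path_algebraI (mbelow t) (munbounded i).
rewrite -(X_below (subst_coord t i r)); apply: X_le => // beta [bt ub] j.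
have [->|ji] := eqVneq j i.
  have [m [[qm qN] bm]] := ub (Num.truncn (- r)).+1; exists m; split=> //; split=> //.
  by rewrite mxE eqxx; apply: lt_trans qN _; rewrite ltrNl truncnS_gt.
by have [m [[qm qt] bm]] := bt j; exists m; split=> //; split=> //; rewrite mxE (negbTE ji).
Qed.

(** The paths along which each infimum in [point] is taken over a nonempty set bounded below;
    elsewhere [inf] may be a default value. *)
Let located : set (nat -> bool) :=
  [set beta | exists N, below (diag_pt R n N) beta] `&`
  [set beta | forall i, (~` unbounded i) beta].

Let mlocated : path_algebra located.
Proof.
apply: path_algebraI; first by apply: path_algebra_exists => N; exact: mbelow.
apply: path_algebra_forall => i.
by have := path_algebraD path_algebraT (munbounded i); rewrite setTD.
Qed.

Let X_below_located t : X (below t `&` located) = H t.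
Proof.
have mI := path_algebraI (mbelow t) mlocated.
apply/eqP; rewrite -X_below eq_le; apply/andP; split; first by apply: X_le => // ? [].
have null (l : seq 'I_n) : path_algebra [set beta | exists i, i \in l /\ unbounded i beta] /\
    X (below t `&` [set beta | exists i, i \in l /\ unbounded i beta]) <= 0.
  elim: l => [|i l [ml Xl]].
    rewrite (_ : [set beta | _] = set0); last by apply/seteqP; split=> // beta [i []].
    by rewrite setI0 X0; split=> //; exact: (@measurable0 _ (g_sigma_algebraType cylinders)).
  have -> : [set beta | exists j, j \in i :: l /\ unbounded j beta] =
      unbounded i `|` [set beta | exists j, j \in l /\ unbounded j beta].
    apply/seteqP; split=> [beta [j [+ bj]]|beta [bi|[j [jl bj]]]].
    - by rewrite in_cons => /orP[/eqP <-|jl]; [left|right; exists j].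
    - by exists i; rewrite mem_head.
    - by exists j; rewrite in_cons jl orbT.
  split; first exact: path_algebraU.
  rewrite setIUr (le_trans (XU _ _))//; try exact: path_algebraI.
  by rewrite -(addr0 0) lg_leD.
have [mN XN] := null (enum 'I_n).
have mIN := path_algebraI (mbelow t) mN.
apply: (@le_trans _ _ (X (below t `&` located) +
  X (below t `&` [set beta | exists i, i \in enum 'I_n /\ unbounded i beta]))).
  apply: le_trans (XU mI mIN); apply: X_le => //; first exact: path_algebraU.
  move=> beta bt; have [[i bi]|nb] := pselect (exists i, unbounded i beta).
    by right; split=> //; exists i; rewrite mem_enum.
  left; split=> //; split=> [|i bi]; last by apply: nb; exists i.
  have [N tN] := lev_diag_pt t; exists N => i.
  have [m [[qm qt] bm]] := bt i; exists m; split=> //; split=> //.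
  exact: lt_le_trans (tN i).
by rewrite -[leRHS]addr0 lg_leD2l.
Qed.

(** Only the positive answers count, so that contradictory paths also receive a point; [point_below]
    holds for them and no separate treatment is needed. *)
Let point beta : 'rV[R]_n := \row_i inf [set qr m | m in [set m | qi m = i /\ beta m]].

Let point_below t beta : located beta -> lower_orthant t (point beta) <-> below t beta.
Proof.
move=> [[N bN] nu].
have ne i : [set qr m | m in [set m | qi m = i /\ beta m]] !=set0.
  by have [m [[qm _] bm]] := bN i; exists (qr m), m.
have lb i : has_lbound [set qr m | m in [set m | qi m = i /\ beta m]].
  have := nu i; apply: contra_notP => nlb L.
  apply: contrapT => hn; apply: nlb; exists (- L%:R) => _ [m [qm bm] <-].
  by rewrite leNgt; apply/negP => qL; apply: hn; exists m.
split=> [h i|h i].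
  have := h i; rewrite mxE => /(inf_lt (ne i))[_ [m [qm bm] <-] qt].
  by exists m; split.
rewrite mxE; have [m [[qm qt] bm]] := h i; apply: le_lt_trans qt.
by apply: inf_lbound => //; exists m.
Qed.

Let pull (A : set 'rV[R]_n) : set (nat -> bool) := located `&` [set beta | A (point beta)].

Let mpull A : borel_rV A -> path_algebra (pull A).
Proof.
rewrite borel_orthants => mA.
suff /(_ _ mA) : <<s @orthants R n >> `<=` [set A | path_algebra (pull A)] by [].
apply: smallest_sub => [|_ [t _ <-]].
  split=> /= [|C mC|C mC].
  - rewrite (_ : pull set0 = set0); last by apply/seteqP; split=> // beta [].
    exact: (@measurable0 _ (g_sigma_algebraType cylinders)).
  - rewrite (_ : pull _ = located `\` pull C); first exact: path_algebraD.
    apply/seteqP; split=> beta [bl]; first by move=> [_ nC]; split=> // -[].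
    by move=> h; split=> //; split=> // bC; apply: h.
  - rewrite (_ : pull _ = \bigcup_i pull (C i)); first exact: path_algebra_bigcup.
    apply/seteqP; split=> [beta [bl [i _ Ci]]|beta [i _ [bl Ci]]]; first by exists i.
    by split=> //; exists i.
rewrite /= (_ : pull _ = below t `&` located); first exact: path_algebraI.
by apply/seteqP; split=> beta [h1 h2]; split=> //; apply/point_below.
Qed.

Let pull_orthant t : X (pull (lower_orthant t)) = H t.
Proof.
rewrite -X_below_located; congr X.
by apply/seteqP; split=> beta [h1 h2]; split=> //; apply/point_below.
Qed.

Let one : lexZ G := (k%:Z, 0).

Let XT : X setT = one.
Proof.
apply/eqP; rewrite eq_le; apply/andP; split.
  rewrite -[setT]/(cylinder [::]) XE.
  have [_] := cell_limit_sup hG dH qi qr H_stable [::]; apply=> _ [N _ <-].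
  by rewrite cell_mass_nil; exact: gammaZ_le1.
apply: (spectral_lub hF) => s; rewrite -[X in X <= _](X_below s); apply: X_le => //.
exact: path_algebraT.
Qed.

Let X_pull_range A : borel_rV A -> 0 <= X (pull A) <= one.
Proof.
move=> mA; have mpA := mpull mA; apply/andP; split; first exact: (vm_ge0 mX).
by rewrite -XT; apply: X_le => //; exact: path_algebraT.
Qed.

Lemma observable_of_tree_measure : exists x : set 'rV[R]_n -> gammaZ G k,
  observable x /\ extends_spectral x F.
Proof.
(* By [X_pull_range] the default [gamma0] is invoked only for sets that are not Borel. *)
pose x A : gammaZ G k := insubd gamma0 (X (pull A)).
have xE A : borel_rV A -> val (x A) = X (pull A).
  by move=> mA; rewrite /x val_insubd X_pull_range.
have mO t : borel_rV (lower_orthant t).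
  by apply: sub_sigma_algebra; exact: orthant_open.
have mT : @borel_rV R n setT.
  exact: (@measurableT _ (g_sigma_algebraType (@open 'rV[R]_n))).
exists x; split; last by move=> t; apply: val_inj; rewrite xE// pull_orthant.
split.
- apply: val_inj; rewrite xE//; apply/eqP; rewrite eq_le.
  have /andP[_ ->] /= := X_pull_range mT.
  (* Only the paths in [located] are counted here, but their mass dominates every [H s], hence the
     top. *)
  apply: (spectral_lub hF) => s; rewrite -[X in X <= _](pull_orthant s).
  by apply: X_le => [||? []//]; exact: mpull.
- move=> A B mA mB AB.
  have mAB : borel_rV (A `|` B).
    exact: (@measurableU _ (g_sigma_algebraType (@open 'rV[R]_n))).
  rewrite /gamma_add_eq !xE// -(vmD mX); try exact: mpull.
    by rewrite /pull -setIUr.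
  rewrite /pull setIACA setIid (_ : _ `&` [set beta | B _] = set0) ?setI0//.
  by apply/seteqP; split=> // beta [a b]; have : (A `&` B) (point beta) by []; rewrite AB.
- move=> A mA Ai.
  have mU : borel_rV (\bigcup_i A i).
    exact: (@bigcupT_measurable _ (g_sigma_algebraType (@open 'rV[R]_n))).
  have pU : pull (\bigcup_i A i) = \bigcup_i pull (A i).
    apply/seteqP; split=> [beta [bl [i _ Ci]]|beta [i _ [bl Ci]]]; first by exists i.
    by split=> //; exists i.
  have [Xub Xle] := vm_sup mX (fun i => mpull (mA i))
    (fun i j ij beta (h : pull (A i) beta) => conj h.1 (Ai i j ij _ h.2)).
  split=> [_ [i _ <-]|z zub]; rewrite -[_ <= _]/(val _ <= val _) !xE// pU.
    by apply: Xub; exists i.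
  apply: Xle => _ [i _ <-]; rewrite -xE//.
  by apply: (zub (x (A i))); exists i.
Qed.

End Extension.

(** * Uniqueness of the extension and conclusion *)

Lemma observable_unique (R : realType) (n k : nat) (G : lgroupType)
    (F : 'rV[R]_n -> gammaZ G k) (x y : set 'rV[R]_n -> gammaZ G k) :
  observable x -> extends_spectral x F -> observable y -> extends_spectral y F ->
  forall A, borel_rV A -> y A = x A.
Proof.
move=> ox xF oy yF; pose M := g_sigma_algebraType (@open 'rV[R]_n).
have diff z A B : @observable R n k G z -> borel_rV A -> borel_rV B -> B `<=` A ->
    val (z (A `\` B)) = val (z A) - val (z B).
  move=> oz mA mB BA; have mAB : borel_rV (A `\` B) by exact: (@measurableD _ M).
  have := observable_add oz mB mAB; rewrite setDIK => /(_ erefl).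
  by rewrite /gamma_add_eq (setDUK BA) => <-; rewrite addrAC subrr add0r.
(* Orthants are stable under intersection and generate the Borel sets; agreement passes to proper
   differences by subtraction in the group, and to increasing unions by uniqueness of suprema. *)
move=> A mA; suff : <<s @orthants R n >> `<=` [set A | borel_rV A /\ y A = x A].
  by rewrite -borel_orthants => /(_ _ mA)[].
apply: lambda_system_subset => //; first exact: orthants_setI.
  split=> //=.
  - split; first exact: (@measurableT _ M).
    by rewrite (observable_setT ox) (observable_setT oy).
  - move=> B C CB [mB yB] [mC yC]; split; first exact: (@measurableD _ M).
    by apply: val_inj; rewrite !diff// yB yC.
  - move=> B Bi h; have mB i : borel_rV (B i) by have [] := h i.
    split; first exact: (@bigcupT_measurable _ M).
    have Bi' i j : (i <= j)%N -> B i `<=` B j by move=> /Bi/subsetPset.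
    apply: supremums_unique (observable_sup oy mB Bi') _.
    rewrite (_ : (fun _ => _) = fun i => x (B i)); first exact: observable_sup.
    by apply/funext => i; have [] := h i.
move=> _ [t _ <-]; split; first by apply: sub_sigma_algebra; exact: orthant_open.
by rewrite xF yF.
Qed.


Theorem theorem4p2 (R : realType) (n k : nat) (hn : (1 <= n)%N) (hk : (1 <= k)%N)
    (G : lgroupType) (hG : dedekind_sigma_complete G)
    (F : 'rV[R]_n -> gammaZ G k)
    (hF : spectral_resolution F) (hord : ordering_property F) :
  exists x : set 'rV[R]_n -> gammaZ G k,
    [/\ observable x, extends_spectral x F &
        forall y : set 'rV[R]_n -> gammaZ G k,
          observable y -> extends_spectral y F ->
          forall A : set 'rV[R]_n, borel_rV A -> y A = x A].
Proof.
(* Each pair of a coordinate and a rational is asked at its own code, whence [q_dense]; the other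
   codes ask a default question, which exists because [n] is positive. *)
pose question m : 'I_n * rat := odflt (Ordinal hn, 0) (unpickle m).
have q_dense i (x y : R) : x < y ->
    exists m, (question m).1 = i /\ x < ratr (question m).2 < y.
  move=> /rat_in_itvoo[q]; rewrite in_itv /= => xqy.
  by exists (pickle (i, q)); rewrite /question pickleK.
have [N H_stable] := spectral_stable hF.
pose p := cell_limit hG (spectral_distribution hF) (fst \o question)
  (fun m => ratr (question m).2) H_stable.
have [||X [mX XE]] := lex_tree_measure R hG (p := p) _ _
  (cell_limit_path_bounded hG hF q_dense H_stable).
- exact: cell_limit_ge0.
- exact: cell_limitD.
have [x [ox xF]] := observable_of_tree_measure q_dense mX XE.
by exists x; split=> // y oy yF; exact: observable_unique ox xF oy yF.
Qed.
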